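(* Let $u\colon R\to U$ be an epimorphism of associative rings such that $\operatorname{Tor}^R_1(U,U)=0$ and the flat dimension of the right $R$-module $U$ does not exceed $1$. Then the category $R\text{-mod}_{u\text{-co}}$ of left $u$-comodules is a Grothendieck abelian category. If $J$ is an injective cogenerator of the abelian category $R\text{-mod}$ of left $R$-modules, then $\Gamma_u(J)$ is an injective cogenerator of $R\text{-mod}_{u\text{-co}}$.
   Context: Rings are associative and unital, not necessarily commutative. A ring homomorphism $u\colon R\to U$ is a ring epimorphism iff the multiplication map $U\otimes_R U\to U$ is an isomorphism; it is not assumed injective. A left $R$-module $M$ is a (left) $u$-comodule if $U\otimes_R M=0=\operatorname{Tor}^R_1(U,M)$; $R\text{-mod}_{u\text{-co}}$ is the full subcategory of $u$-comodules in $R\text{-mod}$. $K^\bullet$ denotes the two-term complex of $R$-$R$-bimodules $R\xrightarrow{u}U$ with $R$ in cohomological degree $-1$ and $U$ in cohomological degree $0$. For a left $R$-module $A$, $\Gamma_u(A)=\operatorname{Tor}_1^R(K^\bullet,A)=H^{-1}(K^\bullet\otimes_R^{\mathbb L}A)$, with the left $R$-module structure induced by the left action of $R$ on $K^\bullet$. *)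

(* Defs.v *)
From HB Require Import structures.
From mathcomp Require Import all_boot all_order all_algebra.
From mathcomp Require Import all_classical.

Set Implicit Arguments.
Unset Strict Implicit.
Unset Printing Implicit Defensive.

Import GRing.Theory.
Local Open Scope quotient_scope.
Local Open Scope classical_set_scope.
Local Open Scope ring_scope.

(* Rings are pzRingType's, so that the zero ring is allowed; left R-modules   *)
(* are lmodType R's.                                                          *)

Record preadditive := Preadditive {
  obj :> Type;
  hom : obj -> obj -> zmodType;
  idc : forall a, hom a a;
  comp : forall a b c, hom b c -> hom a b -> hom a c;
  comp1c : forall a b (f : hom a b), comp (idc b) f = f;
  compc1 : forall a b (f : hom a b), comp f (idc a) = f;
  compA : forall a b c d (h : hom c d) (g : hom b c) (f : hom a b),
    comp h (comp g f) = comp (comp h g) f;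
  compDl : forall a b c (g g' : hom b c) (f : hom a b),
    comp (g + g') f = comp g f + comp g' f;
  compDr : forall a b c (g : hom b c) (f f' : hom a b),
    comp g (f + f') = comp g f + comp g f' }.

Notation "g \c f" := (comp g f) (at level 40, left associativity).

Definition full_subcategory (C : preadditive) (P : C -> Prop) : preadditive :=
  @Preadditive {x : C | P x} (fun x y => hom (sval x) (sval y))
    (fun x => idc (sval x)) (fun x y z g f => g \c f)
    (fun x y f => comp1c f) (fun x y f => compc1 f)
    (fun w x y z h g f => compA h g f)
    (fun x y z g g' f => compDl g g' f) (fun x y z g f f' => compDr g f f').

Section Abelian.
Variable C : preadditive.

Definition mono (a b : C) (f : hom a b) :=
  forall x (g h : hom x a), f \c g = f \c h -> g = h.

Definition epi (a b : C) (f : hom a b) :=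
  forall x (g h : hom b x), g \c f = h \c f -> g = h.

Definition zero_object (z : C) :=
  forall a, (forall f : hom z a, f = 0) /\ (forall f : hom a z, f = 0).

Definition is_biproduct (a b p : C)
    (i : hom a p) (j : hom b p) (q : hom p a) (r : hom p b) :=
  [/\ q \c i = idc a, r \c j = idc b, r \c i = 0, q \c j = 0 &
      i \c q + j \c r = idc p].

Definition is_kernel (k a b : C) (i : hom k a) (f : hom a b) :=
  f \c i = 0 /\
  forall x (g : hom x a), f \c g = 0 -> exists! h : hom x k, i \c h = g.

Definition is_cokernel (a b c : C) (p : hom b c) (f : hom a b) :=
  p \c f = 0 /\
  forall x (g : hom b x), g \c f = 0 -> exists! h : hom c x, h \c p = g.

Record abelian : Prop := Abelian {
  ab_zero : exists z : C, zero_object z;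
  ab_biproduct : forall a b : C, exists (p : C) (i : hom a p) (j : hom b p)
    (q : hom p a) (r : hom p b), is_biproduct i j q r;
  ab_kernel : forall (a b : C) (f : hom a b),
    exists (k : C) (i : hom k a), is_kernel i f;
  ab_cokernel : forall (a b : C) (f : hom a b),
    exists (c : C) (p : hom b c), is_cokernel p f;
  ab_mono : forall (a b : C) (f : hom a b), mono f ->
    exists (c : C) (p : hom b c), is_kernel f p;
  ab_epi : forall (a b : C) (f : hom a b), epi f ->
    exists (k : C) (i : hom k a), is_cokernel f i }.

Definition short_exact (a b c : C) (f : hom a b) (g : hom b c) :=
  is_kernel f g /\ is_cokernel g f.

Definition injective_object (j : C) :=
  forall (a b : C) (i : hom a b), mono i ->
  forall f : hom a j, exists g : hom b j, g \c i = f.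

Definition cogenerator (j : C) :=
  forall (a b : C) (f g : hom a b),
    f <> g -> exists h : hom b j, h \c f <> h \c g.

Definition injective_cogenerator (j : C) := injective_object j /\ cogenerator j.

Definition generator (s : C) :=
  forall (a b : C) (f g : hom a b),
    f <> g -> exists h : hom s a, f \c h <> g \c h.

End Abelian.

(* Index categories. Classically every type is a choiceType; here this class  *)
(* fixes the size: the universe of choiceType's is that of the carriers of    *)
(* modules (see the free modules below), hence smaller than that of the       *)
(* objects of the category of modules.                                        *)
Record small_category := SmallCategory {
  sobj :> choiceType;
  shom : sobj -> sobj -> choiceType;
  sid : forall i, shom i i;
  scomp : forall i j k, shom j k -> shom i j -> shom i k;
  scomp1c : forall i j (f : shom i j), scomp (sid j) f = f;
  scompc1 : forall i j (f : shom i j), scomp f (sid i) = f;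
  scompA : forall i j k l (h : shom k l) (g : shom j k) (f : shom i j),
    scomp h (scomp g f) = scomp (scomp h g) f }.

Record filtered (I : small_category) : Prop := Filtered {
  filt_ob : exists i : I, True;
  filt_join : forall i j : I,
    exists k, (exists f : shom i k, True) /\ (exists g : shom j k, True);
  filt_coeq : forall (i j : I) (f g : shom i j),
    exists k (h : shom j k), scomp h f = scomp h g }.

Record diagram (I : small_category) (C : preadditive) := Diagram {
  dob :> I -> C;
  dmap : forall i j, shom i j -> hom (dob i) (dob j);
  dmap1 : forall i, dmap (sid i) = idc (dob i);
  dmapc : forall i j k (g : shom j k) (f : shom i j),
    dmap (scomp g f) = dmap g \c dmap f }.

Section Grothendieck.
Variable C : preadditive.

Definition cocone (I : small_category) (D : diagram I C) (c : C)
    (t : forall i, hom (D i) c) :=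
  forall i j (f : shom i j), t j \c dmap D f = t i.

Definition is_colimit (I : small_category) (D : diagram I C) (c : C)
    (t : forall i, hom (D i) c) :=
  cocone t /\
  forall x (s : forall i, hom (D i) x), cocone s ->
  exists! h : hom c x, forall i, h \c t i = s i.

Definition cocomplete := forall (I : small_category) (D : diagram I C),
  exists (c : C) (t : forall i, hom (D i) c), is_colimit t.

Definition natural (I : small_category) (D E : diagram I C)
    (t : forall i, hom (D i) (E i)) :=
  forall i j (f : shom i j), t j \c dmap D f = dmap E f \c t i.

Definition exact_filtered_colimits :=
  forall I : small_category, filtered I ->
  forall (D E F : diagram I C)
    (f : forall i, hom (D i) (E i)) (g : forall i, hom (E i) (F i)),
  natural f -> natural g -> (forall i, short_exact (f i) (g i)) ->
  forall (d e c : C) (t : forall i, hom (D i) d) (s : forall i, hom (E i) e)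
    (r : forall i, hom (F i) c),
  is_colimit t -> is_colimit s -> is_colimit r ->
  forall (f' : hom d e) (g' : hom e c),
  (forall i, f' \c t i = s i \c f i) -> (forall i, g' \c s i = r i \c g i) ->
  short_exact f' g'.

Record grothendieck : Prop := Grothendieck {
  groth_abelian : abelian C;
  groth_cocomplete : cocomplete;
  groth_AB5 : exact_filtered_colimits;
  groth_generator : exists s : C, generator s }.

End Grothendieck.

Section LinearMaps.
Variables (R : pzRingType) (A B : lmodType R).

Lemma linear_ext (f g : {linear A -> B}) : f =1 g -> f = g.
Proof.
move=> /funext fg; case: f g fg => f [[f1] [f2]] [g [[g1] [g2]]] /= fg.
subst g.
by rewrite (Prop_irrelevance f1 g1) (Prop_irrelevance f2 g2).
Qed.

HB.instance Definition _ := gen_eqMixin {linear A -> B}.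
HB.instance Definition _ := gen_choiceMixin {linear A -> B}.

Definition lzero : {linear A -> B} := \0.
Definition lopp (f : {linear A -> B}) : {linear A -> B} := \- f.
Definition ladd (f g : {linear A -> B}) : {linear A -> B} := f \+ g.

Fact laddA : associative ladd.
Proof. by move=> f g h; apply: linear_ext => x /=; rewrite addrA. Qed.
Fact laddC : commutative ladd.
Proof. by move=> f g; apply: linear_ext => x /=; rewrite addrC. Qed.
Fact ladd0 : left_id lzero ladd.
Proof. by move=> f; apply: linear_ext => x /=; rewrite add0r. Qed.
Fact laddN : left_inverse lzero lopp ladd.
Proof. by move=> f; apply: linear_ext => x /=; rewrite addNr. Qed.

HB.instance Definition _ :=
  GRing.isZmodule.Build {linear A -> B} laddA laddC ladd0 laddN.
End LinearMaps.

Definition lid (R : pzRingType) (A : lmodType R) : {linear A -> A} := idfun.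
Definition lcomp (R : pzRingType) (A B C : lmodType R)
  (g : {linear B -> C}) (f : {linear A -> B}) : {linear A -> C} := g \o f.

Program Definition module_category (R : pzRingType) : preadditive :=
  @Preadditive (lmodType R) (fun A B => {linear A -> B}) (@lid R) (@lcomp R)
    _ _ _ _ _.
Next Obligation. by move=> R A B f; apply: linear_ext. Qed.
Next Obligation. by move=> R A B f; apply: linear_ext. Qed.
Next Obligation. by move=> R A B C D h g f; apply: linear_ext. Qed.
Next Obligation. by move=> R A B C g g' f; apply: linear_ext. Qed.
Next Obligation.
by move=> R A B C g f f'; apply: linear_ext => x /=; rewrite linearD.
Qed.

Section Free.
Variables (R : pzRingType) (X : choiceType).

Definition finsupp : {pred X -> R^o} :=
  fun f => `[< finite_set [set x | f x != 0] >].

Fact finsupp_submod : submod_closed finsupp.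
Proof.
split=> [|a f g /asboolP ff /asboolP fg]; apply/asboolP.
  by rewrite (_ : mkset _ = set0) // -subset0 => x /=; rewrite eqxx.
apply: (@sub_finite_set _ _ ([set x | f x != 0] `|` [set x | g x != 0])).
  move=> x /=; case: (eqVneq (f x) 0) => [fx|]; last by left.
  by rewrite [X in X != 0](_ : _ = a *: f x + g x) // fx scaler0 add0r; right.
by rewrite finite_setU.
Qed.
HB.instance Definition _ :=
  GRing.isSubmodClosed.Build R (X -> R^o) finsupp finsupp_submod.

Record free :=
  Free { free_fun :> X -> R^o; free_finsupp : free_fun \in finsupp }.
HB.instance Definition _ := [isSub for free_fun].
HB.instance Definition _ := [Choice of free by <:].
HB.instance Definition _ := [SubChoice_isSubLmodule of free by <:].

Fact fgen_subproof (x : X) : (fun y => (y == x)%:R : R^o) \in finsupp.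
Proof.
apply/asboolP; apply: (sub_finite_set _ (finite_set1 x)) => y /=.
by case: (y =P x) => // _; rewrite eqxx.
Qed.
Definition fgen (x : X) : free := Free (fgen_subproof x).

Section Ext.
Variables (T : lmodType R) (g : X -> T).

Definition fext (f : free) : T := \sum_(x \in [set: X]) (f x : R) *: g x.

Fact fext_is_linear : linear fext.
Proof.
move=> a f h; rewrite /fext.
have /asboolP ff := free_finsupp f; have /asboolP fh := free_finsupp h.
pose D := [set x | f x != 0] `|` [set x | h x != 0].
have fD : finite_set D by rewrite finite_setU.
have W (k : free) : (forall x, ~ D x -> k x = 0) ->
    \sum_(x \in [set: X]) (k x : R) *: g x =
    \sum_(x \in D) (k x : R) *: g x.
  move=> kD; apply/esym/fsbig_widen => // x [_ /kD /= ->].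
  by rewrite scale0r.
have f0 x : ~ D x -> f x = 0.
  by move=> nD; apply/eqP/negPn/negP => fx; apply: nD; left.
have h0 x : ~ D x -> h x = 0.
  by move=> nD; apply/eqP/negPn/negP => hx; apply: nD; right.
have afhE x : (a *: f + h) x = a *: f x + h x by [].
rewrite !W //; last by move=> x nD; rewrite afhE f0 // h0 // scaler0 addr0.
rewrite !fsbig_finite //= scaler_sumr -big_split /=; apply: eq_bigr => x _.
by rewrite scalerA -scalerDl.
Qed.
HB.instance Definition _ := GRing.isLinear.Build R free T _ fext fext_is_linear.

Lemma fext_gen x : fext (fgen x) = g x.
Proof.
rewrite /fext -(@fsbig_widen _ _ _ _ [set x]) ?fsbig_set1 //=.
  by rewrite eqxx scale1r.
by move=> y [_ /= /eqP /negPf ->]; rewrite scale0r.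
Qed.
End Ext.
End Free.

Section Quotient.
Variables (R : pzRingType) (M : lmodType R).

Inductive span (B : set M) : set M :=
| span_gen x : B x -> span B x
| span0 : span B 0
| spanP a x y : span B x -> span B y -> span B (a *: x + y).

Variable B : set M.

Definition spanp : {pred M} := fun x => `[< span B x >].
Fact spanp_submod : submod_closed spanp.
Proof.
split=> [|a x y /asboolP Bx /asboolP By]; apply/asboolP; first exact: span0.
exact: spanP.
Qed.
HB.instance Definition _ := GRing.isSubmodClosed.Build R M spanp spanp_submod.

(* M modulo the submodule spanned by B. *)
Definition quomod : Type := Quotient.quot spanp.
HB.instance Definition _ := GRing.Zmodule.on quomod.

Definition qpi (x : M) : quomod := \pi_(Quotient.quot spanp) x.

Lemma qpi_eq x y : qpi x = qpi y <-> span B (x - y).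
Proof.
split=> [/eqP|xy]; first by rewrite -Quotient.idealrBE => /asboolP.
by apply/eqP; rewrite -Quotient.idealrBE; apply/asboolP.
Qed.

Lemma qpi_repr (q : quomod) : qpi (repr (q : Quotient.quot spanp)) = q.
Proof. exact: reprK. Qed.

Lemma qpiD x y : qpi (x + y) = qpi x + qpi y.
Proof. exact: (raddfD \pi_(Quotient.quot spanp)). Qed.

Definition qscale (a : R) (q : quomod) : quomod :=
  qpi (a *: repr (q : Quotient.quot spanp)).

Lemma qscale_pi a x : qscale a (qpi x) = qpi (a *: x).
Proof.
apply/qpi_eq; rewrite -scalerBr -[_ *: _]addr0; apply: spanP (span0 B).
by apply/qpi_eq; rewrite qpi_repr.
Qed.

Fact qscaleA a b q : qscale a (qscale b q) = qscale (a * b) q.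
Proof. by rewrite -[q]qpi_repr !qscale_pi scalerA. Qed.
Fact qscale1 : left_id 1 qscale.
Proof. by move=> q; rewrite -[q]qpi_repr qscale_pi scale1r. Qed.
Fact qscaleDr : right_distributive qscale +%R.
Proof.
move=> a p q; rewrite -[p]qpi_repr -[q]qpi_repr -qpiD !qscale_pi -qpiD.
by rewrite scalerDr.
Qed.
Fact qscaleDl q : {morph qscale^~ q : a b / a + b}.
Proof. by move=> a b; rewrite -[q]qpi_repr !qscale_pi -qpiD scalerDl. Qed.

HB.instance Definition _ :=
  GRing.Zmodule_isLmodule.Build R quomod qscaleA qscale1 qscaleDr qscaleDl.

Fact qpi_is_linear : linear qpi.
Proof. by move=> a x y; rewrite qpiD -qscale_pi. Qed.
HB.instance Definition _ := GRing.isLinear.Build R M quomod _ qpi qpi_is_linear.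

Section Lift.
Variables (T : lmodType R) (f : {linear M -> T}) (fB : forall b, B b -> f b = 0).

(* The map induced by f; fB is an argument so that the instance applies. *)
Definition qlift of (forall b, B b -> f b = 0) := fun q : quomod =>
  f (repr (q : Quotient.quot spanp)).

Lemma qlift_pi x : qlift fB (qpi x) = f x.
Proof.
suff W y : span B y -> f y = 0.
  apply/eqP; rewrite -subr_eq0 -linearB; apply/eqP/W/qpi_eq.
  by rewrite qpi_repr.
by elim=> [||a u v _ fu _ fv]; rewrite ?linear0 // linearP fu fv scaler0 addr0.
Qed.

Fact qlift_is_linear : linear (qlift fB).
Proof.
move=> a p q; rewrite -[p]qpi_repr -[q]qpi_repr -linearP !qlift_pi.
by rewrite linearP.
Qed.
HB.instance Definition _ :=
  GRing.isLinear.Build R quomod T _ (qlift fB) qlift_is_linear.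
End Lift.
End Quotient.

Section Homology.
Variables (R : pzRingType) (A B C : lmodType R).

Section Kernel.
Variable g : {linear B -> C}.
Definition kerp : {pred B} := fun x => g x == 0.
Fact kerp_submod : submod_closed kerp.
Proof.
split=> [|a x y /eqP gx /eqP gy]; apply/eqP; first exact: linear0.
by rewrite linearP gx gy scaler0 addr0.
Qed.
HB.instance Definition _ := GRing.isSubmodClosed.Build R B kerp kerp_submod.

Record kermod := Kermod { kermod_val :> B; kermodP : kermod_val \in kerp }.
HB.instance Definition _ := [isSub for kermod_val].
HB.instance Definition _ := [Choice of kermod by <:].
HB.instance Definition _ := [SubChoice_isSubLmodule of kermod by <:].
End Kernel.

(* ker g / im f, for A -f-> B -g-> C with g \o f = 0. *)
Definition homology (f : {linear A -> B}) (g : {linear B -> C}) : lmodType R :=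
  quomod [set x : kermod g | exists a, f a = x :> B].
End Homology.

Definition is_zero (R : pzRingType) (M : lmodType R) := forall x : M, x = 0.

(* S-R-bimodules; right R-modules are the int-R-bimodules. *)
Record bimodule (S R : pzRingType) := Bimodule {
  bisort :> lmodType S;
  ract : bisort -> R -> bisort;
  ractDl : forall n n' r, ract (n + n') r = ract n r + ract n' r;
  ractZl : forall s n r, ract (s *: n) r = s *: ract n r;
  ractDr : forall n r r', ract n (r + r') = ract n r + ract n r';
  ract1 : forall n, ract n 1 = n;
  ractM : forall n r r', ract n (r * r') = ract (ract n r) r' }.

Notation right_module R := (bimodule int R).

Record bimorphism (S R : pzRingType) (N N' : bimodule S R) := Bimorphism {
  bifun :> {linear N -> N'};
  bifunr : forall n r, bifun (ract n r) = ract (bifun n) r }.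

Definition biid (S R : pzRingType) (N : bimodule S R) : bimorphism N N :=
  @Bimorphism S R N N (lid N) (fun n r => erefl).

Section Tensor.
Variables (S R : pzRingType).

Section Def.
Variables (N : bimodule S R) (M : lmodType R).
Local Notation "[ n , m ]" := (@fgen S (N * M)%type (n, m)).

Inductive tens_rel : set (free S (N * M)%type) :=
| tens_relDl n n' m : tens_rel ([n + n', m] - ([n, m] + [n', m]))
| tens_relDr n m m' : tens_rel ([n, m + m'] - ([n, m] + [n, m']))
| tens_relM n r m : tens_rel ([ract n r, m] - [n, r *: m])
| tens_relZ s n m : tens_rel ([s *: n, m] - s *: [n, m]).

(* N (x)_R M. The relations tens_relZ present it as a left S-module directly: *)
(* they define the action of S, and follow from the others for S = int.       *)
Definition tens : lmodType S := quomod tens_rel.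

Definition tpure (n : N) (m : M) : tens := qpi tens_rel [n, m].

Lemma tpureDl n n' m : tpure (n + n') m = tpure n m + tpure n' m.
Proof.
by rewrite /tpure -linearD; apply/qpi_eq/span_gen; apply: tens_relDl.
Qed.
Lemma tpureDr n m m' : tpure n (m + m') = tpure n m + tpure n m'.
Proof.
by rewrite /tpure -linearD; apply/qpi_eq/span_gen; apply: tens_relDr.
Qed.
Lemma tpureM n r m : tpure (ract n r) m = tpure n (r *: m).
Proof. by apply/qpi_eq/span_gen; apply: tens_relM. Qed.
Lemma tpureZ s n m : tpure (s *: n) m = s *: tpure n m.
Proof. by rewrite /tpure -linearZ; apply/qpi_eq/span_gen/tens_relZ. Qed.
End Def.

Section Map.
Variables (N N' : bimodule S R) (M M' : lmodType R).
Variables (p : bimorphism N N') (f : {linear M -> M'}).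

Definition tmap_free : {linear free S (N * M)%type -> tens N' M'} :=
  fext (fun x => tpure (p x.1) (f x.2)).

Fact tmap_rel b : tens_rel b -> tmap_free b = 0.
Proof.
have pE n m : tmap_free (fgen S (n, m)) = tpure (p n) (f m).
  by rewrite /tmap_free /= fext_gen.
case=> [n n' m|n m m'|n r m|s n m]; rewrite linearB.
- by rewrite [X in _ - X]linearD !pE linearD tpureDl subrr.
- by rewrite [X in _ - X]linearD !pE linearD tpureDr subrr.
- by rewrite !pE linearZ bifunr tpureM subrr.
- by rewrite [X in _ - X]linearZ !pE linearZ tpureZ subrr.
Qed.

Definition tmap : tens N M -> tens N' M' := qlift tmap_rel.
HB.instance Definition _ := GRing.Linear.on tmap.

Lemma tmap_pure n m : tmap (tpure n m) = tpure (p n) (f m).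
Proof. exact: etrans (qlift_pi _ _) (fext_gen _ _). Qed.
End Map.
End Tensor.
Arguments tmap : simpl never.

Definition flat (R : pzRingType) (N : right_module R) :=
  forall (A B : lmodType R) (f : {linear A -> B}),
    injective f -> injective (tmap (biid N) f).

(* N has a flat resolution 0 -> F_n -> .. -> F_0 -> N -> 0 *)
Fixpoint flat_dim_le (R : pzRingType) (n : nat) (N : right_module R) : Prop :=
  if n is n'.+1 then
    exists (K F : right_module R) (f : bimorphism K F) (g : bimorphism F N),
      [/\ injective f, (forall x, g x = 0 <-> exists y, f y = x),
          (forall y, exists x, g x = y), flat F & flat_dim_le n' K]
  else flat N.

(* The canonical free resolution .. P2 -> P1 -> P0 -> M: each P_i is free on  *)
(* the underlying set of the kernel of the preceding map.                     *)
Section Resolution.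
Variable R : pzRingType.

Definition cover (A B : lmodType R) (f : {linear A -> B}) :
  {linear free R (kermod f) -> A} := fext (fun x : kermod f => x : A).

Variable M : lmodType R.
Definition P0 : lmodType R := free R M.
Definition augm : {linear P0 -> M} := fext (fun x : M => x).
Definition P1 : lmodType R := free R (kermod augm).
Definition d1 : {linear P1 -> P0} := cover augm.
Definition P2 : lmodType R := free R (kermod d1).
Definition d2 : {linear P2 -> P1} := cover d1.
End Resolution.

Definition Tor1 (S R : pzRingType) (N : bimodule S R) (M : lmodType R) :
  lmodType S := homology (tmap (biid N) (d2 M)) (tmap (biid N) (d1 M)).

Section Cone.
Variables (S R : pzRingType) (N N' : bimodule S R) (k : bimorphism N N').
Variable M : lmodType R.

(* The total complex of K (x) P, where K is the complex N -k-> N' with N in   *)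
(* degree -1 and N' in degree 0, in total degrees -2, -1, 0. The differential *)
(* is d(n (x) p) = k(n) (x) p - n (x) d(p) and d(n' (x) p) = n' (x) d(p).     *)
Definition tot2 : lmodType S := (tens N (P1 M) * tens N' (P2 M))%type.
Definition tot1 : lmodType S := (tens N (P0 M) * tens N' (P1 M))%type.
Definition tot0 : lmodType S := tens N' (P0 M).

Definition dtot2_fun (x : tot2) : tot1 :=
  (- tmap (biid N) (d1 M) x.1,
   tmap k (lid (P1 M)) x.1 + tmap (biid N') (d2 M) x.2).
Fact dtot2_is_linear : linear dtot2_fun.
Proof.
move=> a [x x'] [y y']; congr (_, _) => /=.
  by rewrite [tmap _ _ _]linearP opprD scalerN.
by rewrite !linearP scalerDr addrACA.
Qed.
HB.instance Definition _ :=
  GRing.isLinear.Build S tot2 tot1 _ dtot2_fun dtot2_is_linear.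
Definition dtot2 : {linear tot2 -> tot1} := dtot2_fun.

Definition dtot1_fun (x : tot1) : tot0 :=
  tmap k (lid (P0 M)) x.1 + tmap (biid N') (d1 M) x.2.
Fact dtot1_is_linear : linear dtot1_fun.
Proof.
move=> a [x x'] [y y']; rewrite /dtot1_fun [in LHS]/= !linearP scalerDr.
by rewrite addrACA.
Qed.
HB.instance Definition _ :=
  GRing.isLinear.Build S tot1 tot0 _ dtot1_fun dtot1_is_linear.
Definition dtot1 : {linear tot1 -> tot0} := dtot1_fun.

Definition Tor1_complex : lmodType S := homology dtot2 dtot1.
End Cone.

Definition ring_epi (R U : pzRingType) (u : {rmorphism R -> U}) :=
  forall (T : pzRingType) (f g : {rmorphism U -> T}),
    f \o u =1 g \o u -> f =1 g.

Section Restriction.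
Variables (R U : pzRingType) (u : {rmorphism R -> U}).

(* U with the left action of R through u. *)
Definition restr of {rmorphism R -> U} : Type := U.
HB.instance Definition _ := GRing.Zmodule.on (restr u).

Definition restr_scale (r : R) (x : restr u) : restr u := u r * (x : U).
Fact restr_scaleA a b x : restr_scale a (restr_scale b x) = restr_scale (a * b) x.
Proof. by rewrite /restr_scale rmorphM mulrA. Qed.
Fact restr_scale1 : left_id 1 restr_scale.
Proof. by move=> x; rewrite /restr_scale rmorph1 mul1r. Qed.
Fact restr_scaleDr : right_distributive restr_scale +%R.
Proof. by move=> r x y; rewrite /restr_scale mulrDr. Qed.
Fact restr_scaleDl x : {morph restr_scale^~ x : a b / a + b}.
Proof. by move=> a b; rewrite /restr_scale rmorphD mulrDl. Qed.
HB.instance Definition _ := GRing.Zmodule_isLmodule.Build R (restr u)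
  restr_scaleA restr_scale1 restr_scaleDr restr_scaleDl.

Definition regular_bimodule : bimodule R R :=
  @Bimodule R R R^o (fun x r => x * r)
    (@mulrDl R) (fun s x r => esym (mulrA s x r)) (@mulrDr R) (@mulr1 R)
    (@mulrA R).

Definition restr_ract (x : restr u) (r : R) : restr u := (x : U) * u r.
Fact restr_ractDl x y r :
  restr_ract (x + y) r = restr_ract x r + restr_ract y r.
Proof. exact: (@mulrDl U). Qed.
Fact restr_ractZl s x r : restr_ract (s *: x) r = s *: restr_ract x r.
Proof. exact/esym/(@mulrA U). Qed.
Fact restr_ractMz (n : int) x r :
  restr_ract (n *: (x : zmodule U)) r = n *: (restr_ract x r : zmodule U).
Proof. exact: (@mulrzAl U). Qed.
Fact restr_ractDr x r s : restr_ract x (r + s) = restr_ract x r + restr_ract x s.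
Proof. by rewrite /restr_ract rmorphD; apply: (@mulrDr U). Qed.
Fact restr_ract1 x : restr_ract x 1 = x.
Proof. by rewrite /restr_ract rmorph1; apply: (@mulr1 U). Qed.
Fact restr_ractM x r s : restr_ract x (r * s) = restr_ract (restr_ract x r) s.
Proof. by rewrite /restr_ract rmorphM; apply: (@mulrA U). Qed.

Definition restr_bimodule : bimodule R R :=
  @Bimodule R R (restr u) restr_ract restr_ractDl restr_ractZl restr_ractDr
    restr_ract1 restr_ractM.

Definition restr_right : right_module R :=
  @Bimodule int R (zmodule U) restr_ract restr_ractDl restr_ractMz restr_ractDr
    restr_ract1 restr_ractM.

Definition restr_unit_fun (x : R^o) : restr u := u x.
Fact restr_unit_is_linear : linear restr_unit_fun.
Proof. by move=> a x y; rewrite /restr_unit_fun rmorphD rmorphM. Qed.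
HB.instance Definition _ :=
  GRing.isLinear.Build R R^o (restr u) _ restr_unit_fun restr_unit_is_linear.

Definition restr_unit : bimorphism regular_bimodule restr_bimodule :=
  @Bimorphism R R regular_bimodule restr_bimodule
    (restr_unit_fun : {linear R^o -> restr u}) (fun x r => rmorphM u x r).

Definition comodule (M : lmodType R) :=
  is_zero (tens restr_bimodule M) /\ is_zero (Tor1 restr_bimodule M).

Definition comodule_category : preadditive :=
  full_subcategory (comodule : module_category R -> Prop).

Definition Gamma (A : lmodType R) : lmodType R := Tor1_complex restr_unit A.

End Restriction.

(* Main.v *)
Require Import Defs.
From HB Require Import structures.
From mathcomp Require Import all_boot all_order all_algebra.
From mathcomp Require Import all_classical.

Set Implicit Arguments.
Unset Strict Implicit.
Unset Printing Implicit Defensive.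

Import Defs GRing.Theory.
Local Open Scope ring_scope.


(** Write U (x) M for the tensor product over R, and fix a flat resolution
    0 -> F1 -> F0 -> U -> 0 of the right module U. Comparing it with a free
    resolution of M shows that M is a comodule if and only if the map
    phi : F1 (x) M -> F0 (x) M is bijective: its cokernel is U (x) M and its
    kernel is Tor1(U, M) ([comodule_phi]). As F1 (x) - and F0 (x) - are exact
    and preserve colimits, comodules are closed under kernels, cokernels and
    colimits of modules. So they form an abelian category, exactly embedded in
    all modules, in which filtered colimits are computed as for modules and
    hence are exact ([comodule_abelian], [comodule_AB5]). A generator comes from
    a Skolem hull: an equation s (x) y = 0 in U (x) M involves finitely many
    elements of M, so each x in M lies in a subcomodule enumerated by terms in a
    fixed language that depends on R and U alone; the coproduct of all
    comodules with such an enumeration generates ([small_subcomodule],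
    [comodule_generator]).

    For the second half, call a module a U-module if its R-action extends to U.
    As u is an epimorphism, R-linear maps between U-modules are U-linear
    ([action_linear]); hence s (x) y = 1 (x) (s y) in U (x) Y for a U-module Y,
    and a splitting argument reduces Tor1(U, Y) = 0 to Tor1(U, U) = 0
    ([phi_action_inj]).

    Gamma(A) is the homology in degree 1 of a complex X of modules
    X_j = P_(j-1) + U (x) P_j, where P is the free resolution of A. The map phi
    is injective on each X_j, and U (x) X is contractible, because it is the
    cone of an isomorphism; the short exact sequence of complexes
    0 -> F1 (x) X -> F0 (x) X -> U (x) X -> 0 then shows that phi is bijective
    on Gamma(A) ([homology_comodule], [Gamma_comodule]).

    Finally there is a map e : Gamma(A) -> A whose kernel is the U-module
    Tor1(U, A) and whose image is the kernel of A -> U (x) A. If M is a comodule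
    and Y a U-module then Hom(M, Y) = 0 = Ext1(M, Y): a map M -> Y factors
    through U (x) M = 0, and an extension 0 -> Y -> E -> M -> 0 becomes an
    isomorphism U (x) Y = U (x) E, which yields a retraction E -> Y. Hence each
    map M -> A lifts uniquely along e ([Gamma_coreflection]): Gamma is right
    adjoint to the exact inclusion of comodules into modules, so it sends an
    injective cogenerator to an injective cogenerator. *)

(** * Tensor products and their universal property *)
Definition pack_linear (R : pzRingType) (A B : lmodType R) (f : A -> B)
    (fL : linear f) : {linear A -> B} :=
  HB.pack_for {linear A -> B} f (GRing.isLinear.Build _ _ _ _ _ fL).

Definition pack_additive (A B : zmodType) (f : A -> B)
    (fD : zmod_morphism f) : {additive A -> B} :=
  HB.pack_for {additive A -> B} f (GRing.isZmodMorphism.Build _ _ _ fD).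

(** The additive maps N -> V, a left R-module through the right action on N. The
    linear maps M -> coind N V are the additive maps N (x) M -> V, so that
    homomorphisms out of a module control additive maps out of a tensor
    product. *)
Section Coinduced.
Variables (S R : pzRingType) (N : bimodule S R) (V : zmodType).

Record coind := Coind {
  coind_fun :> N -> V;
  coindD : forall x y, coind_fun (x + y) = coind_fun x + coind_fun y }.

Lemma coind_ext (f g : coind) : f =1 g -> f = g.
Proof.
case: f g => [f fD] [g gD] /= /funext fg; subst g.
by rewrite (Prop_irrelevance fD gD).
Qed.

HB.instance Definition _ := gen_eqMixin coind.
HB.instance Definition _ := gen_choiceMixin coind.

Definition coind_zero : coind := @Coind (fun=> 0) (fun _ _ => esym (addr0 0)).
Fact coind_oppD (f : coind) x y : - f (x + y) = - f x + - f y.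
Proof. by rewrite coindD opprD. Qed.
Definition coind_opp (f : coind) := Coind (coind_oppD f).
Fact coind_addD (f g : coind) x y :
  f (x + y) + g (x + y) = f x + g x + (f y + g y).
Proof. by rewrite !coindD addrACA. Qed.
Definition coind_add (f g : coind) := Coind (coind_addD f g).

Fact coind_addA : associative coind_add.
Proof. by move=> f g h; apply: coind_ext => x /=; rewrite addrA. Qed.
Fact coind_addC : commutative coind_add.
Proof. by move=> f g; apply: coind_ext => x /=; rewrite addrC. Qed.
Fact coind_add0 : left_id coind_zero coind_add.
Proof. by move=> f; apply: coind_ext => x /=; rewrite add0r. Qed.
Fact coind_addN : left_inverse coind_zero coind_opp coind_add.
Proof. by move=> f; apply: coind_ext => x /=; rewrite addNr. Qed.
HB.instance Definition _ :=
  GRing.isZmodule.Build coind coind_addA coind_addC coind_add0 coind_addN.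

Fact coind_scaleD r (f : coind) x y :
  f (ract (x + y) r) = f (ract x r) + f (ract y r).
Proof. by rewrite ractDl coindD. Qed.
Definition coind_scale r (f : coind) := Coind (coind_scaleD r f).
Fact coind_scaleA a b f :
  coind_scale a (coind_scale b f) = coind_scale (a * b) f.
Proof. by apply: coind_ext => x /=; rewrite ractM. Qed.
Fact coind_scale1 : left_id 1 coind_scale.
Proof. by move=> f; apply: coind_ext => x /=; rewrite ract1. Qed.
Fact coind_scaleDr : right_distributive coind_scale +%R.
Proof. by move=> a f g; apply: coind_ext. Qed.
Fact coind_scaleDl f : {morph coind_scale^~ f : a b / a + b}.
Proof. by move=> a b; apply: coind_ext => x /=; rewrite ractDr coindD. Qed.
HB.instance Definition _ := GRing.Zmodule_isLmodule.Build R coind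
  coind_scaleA coind_scale1 coind_scaleDr coind_scaleDl.
End Coinduced.

Lemma free_ind (R : pzRingType) (X : choiceType) (P : free R X -> Prop) :
  P 0 -> (forall a x z, P z -> P (a *: fgen R x + z)) -> forall z, P z.
Proof.
move=> P0 PD z.
have /asboolP/finite_seqP[s sE] := free_finsupp z.
suff -> : z = \sum_(x <- undup s) (z x : R) *: fgen R x.
  by elim: (undup s) => [|x r IH]; rewrite ?big_nil // big_cons; apply: PD.
apply/val_inj/funext => y /=.
have ev : {morph (fun w : free R X => w y : R) : v w / v + w >-> v + w} by [].
rewrite (big_morph _ ev (id1 := 0)) //=.
suff E : \sum_(i <- undup s) (z i : R) * (y == i)%:R = z y by apply/esym/E.
have [ys|ys] := boolP (y \in s).
  rewrite (bigD1_seq y) ?mem_undup ?undup_uniq //= eqxx mulr1 big1 ?addr0 //.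
  by move=> i; rewrite eq_sym => /negPf ->; rewrite mulr0.
rewrite big1_seq => [|i /=].
  apply/esym/eqP/negPn/negP => zy.
  have : [set x | z x != 0]%classic y by [].
  by rewrite sE /= (negPf ys).
by rewrite mem_undup; case: (y =P i) => [<-|_]; rewrite ?(negPf ys) ?mulr0.
Qed.

Section TensorProduct.
Variables (S R : pzRingType) (N : bimodule S R) (M : lmodType R).

Lemma tens_ind (P : tens N M -> Prop) :
  P 0 -> (forall n m, P (tpure n m)) -> (forall x y, P x -> P y -> P (x + y)) ->
  forall z, P z.
Proof.
move=> P0 Pp PD z; rewrite -[z]qpi_repr.
elim/free_ind: (repr _) => [|a [n m] w IH]; first by rewrite linear0.
rewrite linearP; apply: PD => //.
by rewrite [X in P X](_ : _ = tpure (a *: n) m) // tpureZ.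
Qed.

Lemma tpure0l m : tpure 0 m = 0 :> tens N M.
Proof. by rewrite -(scale0r 0) tpureZ scale0r. Qed.
Lemma tpure0r n : tpure n 0 = 0 :> tens N M.
Proof. by apply: (@addrI _ (tpure n 0)); rewrite addr0 -tpureDr addr0. Qed.
Lemma tpureNl n m : tpure (- n) m = - tpure n m :> tens N M.
Proof. by rewrite -!scaleN1r tpureZ. Qed.
Lemma tpureNr n m : tpure n (- m) = - tpure n m :> tens N M.
Proof. by apply/eqP; rewrite -addr_eq0 -tpureDr addNr tpure0r. Qed.

Lemma tens_additive_eq (V : zmodType) (f g : {additive tens N M -> V}) :
  (forall n m, f (tpure n m) = g (tpure n m)) -> f =1 g.
Proof.
move=> fg; elim/tens_ind => // [|x y fx fy]; first by rewrite !raddf0.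
by rewrite !raddfD fx fy.
Qed.

(** The tensor product is presented as a left S-module, whereas b is only
    additive. Coinduction along the integers repairs this: the map
    (n, m) |-> (s |-> b (s n) m) with values in the coinduced S-module is
    S-linear in n, and evaluation at s = 1 recovers b. *)
Lemma tens_lift (V : zmodType) (b : N -> M -> V) :
  (forall n n' m, b (n + n') m = b n m + b n' m) ->
  (forall n m m', b n (m + m') = b n m + b n m') ->
  (forall n r m, b (ract n r) m = b n (r *: m)) ->
  {f : {additive tens N M -> V} | forall n m, f (tpure n m) = b n m}.
Proof.
move=> bDl bDr bM.
have thD n m (s s' : regular_bimodule S) :
    b ((s + s' : S) *: n) m = b (s *: n) m + b (s' *: n) m.
  by rewrite scalerDl bDl.
pose th (x : (N * M)%type) : coind (regular_bimodule S) V :=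
  Coind (thD x.1 x.2).
pose L : {linear free S (N * M)%type -> coind (regular_bimodule S) V} :=
  fext th.
have LE n m : L (fgen S (n, m)) = th (n, m) by rewrite /L /= fext_gen.
have th_rel z : tens_rel z -> L z = 0.
  case=> [n n' m|n m m'|n r m|s n m]; rewrite linearB ?[L (_ + _)]linearD
      ?[L (_ *: _)]linearZ !LE; apply/eqP; rewrite subr_eq0;
    apply/eqP/coind_ext => x /=.
  - by rewrite scalerDr bDl.
  - by rewrite bDr.
  - by rewrite -bM ractZl.
  - by rewrite scalerA.
pose f0 : {linear tens N M -> coind (regular_bimodule S) V} := qlift th_rel.
have fD : zmod_morphism (fun z => f0 z 1) by move=> x y; rewrite linearB.
exists (pack_additive fD) => n m.
have f0E : f0 (tpure n m) = th (n, m) := etrans (qlift_pi th_rel _) (LE n m).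
pose ev (t : coind (regular_bimodule S) V) := t 1.
by apply: etrans (congr1 ev f0E) _; rewrite /ev /= scale1r.
Qed.

Lemma tens_lift_linear (V : lmodType S) (b : N -> M -> V) :
  (forall n n' m, b (n + n') m = b n m + b n' m) ->
  (forall n m m', b n (m + m') = b n m + b n m') ->
  (forall n r m, b (ract n r) m = b n (r *: m)) ->
  (forall s n m, b (s *: n) m = s *: b n m) ->
  {f : {linear tens N M -> V} | forall n m, f (tpure n m) = b n m}.
Proof.
move=> bDl bDr bM bZ; have [f fE] := tens_lift bDl bDr bM.
have fL : linear f.
  move=> a x y; rewrite raddfD; congr (_ + _).
  elim/tens_ind: x => [|n m|x z IHx IHz].
  - by rewrite scaler0 raddf0 scaler0.
  - by rewrite -tpureZ !fE bZ.
  - by rewrite scalerDr !raddfD IHx IHz.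
by exists (pack_linear fL).
Qed.
End TensorProduct.

(** * Exactness of tensor products *)
Lemma linear_inj (R : pzRingType) (A B : lmodType R) (f : {linear A -> B}) :
  (forall x, f x = 0 -> x = 0) -> injective f.
Proof.
by move=> f0 x y /eqP; rewrite -subr_eq0 -linearB => /eqP/f0/subr0_eq.
Qed.

Lemma span_image (R : pzRingType) (A B : lmodType R) (f : {linear A -> B}) y :
  span [set y | exists x, f x = y]%classic y -> exists x, f x = y.
Proof.
elim=> [x [a <-]||a u v _ [x <-] _ [x' <-]]; first by exists a.
  by exists 0; rewrite linear0.
by exists (a *: x + x'); rewrite linearP.
Qed.

Lemma qpi_surj (R : pzRingType) (A : lmodType R) (B : set A) (q : quomod B) :
  exists x, qpi B x = q.
Proof. by exists (repr (q : Quotient.quot (spanp B))); apply: qpi_repr. Qed.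

Section TensorMaps.
Variables (S R : pzRingType).
Implicit Types (N : bimodule S R) (M : lmodType R).

Section Additivity.
Variables (N N' : bimodule S R) (M M' : lmodType R).
Variables (p : bimorphism N N') (f : {linear M -> M'}).
Lemma tmap0 : tmap p f 0 = 0. Proof. exact: linear0. Qed.
Lemma tmapD x y : tmap p f (x + y) = tmap p f x + tmap p f y.
Proof. exact: linearD. Qed.
Lemma tmapN x : tmap p f (- x) = - tmap p f x. Proof. exact: linearN. Qed.
Lemma tmapB x y : tmap p f (x - y) = tmap p f x - tmap p f y.
Proof. exact: linearB. Qed.
End Additivity.

Lemma tmap_comp N N' N'' M M' M'' (p : bimorphism N' N'') (p' : bimorphism N N')
    (q : bimorphism N N'') (f : {linear M' -> M''}) (f' : {linear M -> M'})
    (g : {linear M -> M''}) :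
  (forall n, p (p' n) = q n) -> (forall m, f (f' m) = g m) ->
  forall z, tmap p f (tmap p' f' z) = tmap q g z.
Proof.
move=> pE fE; elim/tens_ind => [|n m|x y IHx IHy].
  by rewrite !tmap0.
  by rewrite !tmap_pure pE fE.
by rewrite !tmapD IHx IHy.
Qed.

Lemma tmap_swap N N' M M' (p : bimorphism N N') (f : {linear M -> M'}) z :
  tmap p (lid M') (tmap (biid N) f z) = tmap (biid N') f (tmap p (lid M) z).
Proof.
rewrite (@tmap_comp _ _ _ _ _ _ _ _ p _ _ f) //.
by rewrite (@tmap_comp _ _ _ _ _ _ _ _ p _ _ f).
Qed.

Lemma tmap_idcomp N M M' M'' (f : {linear M' -> M''}) (f' : {linear M -> M'})
    (g : {linear M -> M''}) :
  (forall m, f (f' m) = g m) ->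
  forall z, tmap (biid N) f (tmap (biid N) f' z) = tmap (biid N) g z.
Proof. by move=> fE; apply: tmap_comp. Qed.

Lemma tmap_id N M (f : {linear M -> M}) :
  (forall m, f m = m) -> forall z, tmap (biid N) f z = z.
Proof.
move=> fE; elim/tens_ind => [|n m|x y IHx IHy]; first by rewrite !tmap0.
  by rewrite !tmap_pure fE.
by rewrite !tmapD IHx IHy.
Qed.

Lemma tmap_addr N N' M M' (p : bimorphism N N') (f g h : {linear M -> M'}) :
  (forall m, h m = f m + g m) -> forall z, tmap p h z = tmap p f z + tmap p g z.
Proof.
move=> hE; elim/tens_ind => [|n m|x y IHx IHy]; first by rewrite !tmap0 addr0.
  by rewrite !tmap_pure hE tpureDr.
by rewrite !tmapD IHx IHy addrACA.
Qed.

Lemma tmap_zero N M M' (p : bimorphism N N) (f : {linear M -> M'}) :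
  (forall m, f m = 0) -> forall z, tmap p f z = 0.
Proof.
move=> fE; elim/tens_ind => [|n m|x y IHx IHy]; first by rewrite !tmap0.
  by rewrite !tmap_pure fE tpure0r.
by rewrite !tmapD IHx IHy addr0.
Qed.

Section Surjective.
Variables (N N' : bimodule S R) (M M' : lmodType R).
Variables (p : bimorphism N N') (f : {linear M -> M'}).
Hypotheses (p_surj : forall y, exists x, p x = y).
Hypotheses (f_surj : forall y, exists x, f x = y).

Lemma tmap_surj z : exists w, tmap p f w = z.
Proof.
elim/tens_ind: z => [|n m|x y [w <-] [w' <-]].
- by exists 0; rewrite tmap0.
- have [n' <-] := p_surj n; have [m' <-] := f_surj m.
  by exists (tpure n' m'); rewrite tmap_pure.
- by exists (w + w'); rewrite tmapD.
Qed.

(** The kernel of p (x) f is no larger than it has to be: once I identifies any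
    two pure tensors with the same image, choosing preimages in both variables
    defines an inverse of the induced map from (N (x) M) / I. Right exactness in
    each of the two variables is a special case. *)
Lemma tmap_ker (I : set (tens N M)) :
  (forall n n' m m', p n = p n' -> f m = f m' ->
     span I (tpure n m - tpure n' m')) ->
  forall z, tmap p f z = 0 -> span I z.
Proof.
move=> I_ker z z0.
have [s sK] := choice p_surj; have [t tK] := choice f_surj.
pose b n m := qpi I (tpure (s n) (t m)).
have bE n m : b (p n) (f m) = qpi I (tpure n m).
  by apply/qpi_eq/I_ker; rewrite ?sK ?tK.
have [||||h hE] := @tens_lift_linear _ _ N' M' _ b.
- move=> n n' m; rewrite -[n]sK -[n']sK -[m]tK -linearD !bE -linearD.
  by rewrite tpureDl.
- move=> n m m'; rewrite -[n]sK -[m]tK -[m']tK -linearD !bE -linearD.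
  by rewrite tpureDr.
- move=> n r m; rewrite -[n]sK -[m]tK -linearZ -bifunr !bE.
  by rewrite tpureM.
- move=> a n m; rewrite -[n]sK -[m]tK -linearZ !bE -linearZ.
  by rewrite tpureZ.
have hz w : h (tmap p f w) = qpi I w.
  elim/tens_ind: w => [|n m|x y IHx IHy]; first by rewrite ?tmap0 ?linear0.
    by rewrite tmap_pure hE bE.
  by rewrite tmapD (linearD h) IHx IHy -linearD.
rewrite -[z]subr0; apply/qpi_eq.
by rewrite -hz z0 !linear0.
Qed.
End Surjective.

Lemma tens_rexact N (A B C : lmodType R) (f : {linear A -> B})
    (g : {linear B -> C}) :
  (forall c, exists b, g b = c) -> (forall b, g b = 0 -> exists a, f a = b) ->
  forall z, tmap (biid N) g z = 0 -> exists w, tmap (biid N) f w = z.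
Proof.
move=> g_surj fg z /tmap_ker zI; apply/span_image/zI => //.
  by move=> n; exists n.
move=> n n' m m' nn' gm; have {nn'}<- : n = n' := nn'.
apply: span_gen.
have [|a am] := fg (m - m'); first by rewrite linearB gm subrr.
by exists (tpure n a); rewrite /= tmap_pure am tpureDr tpureNr.
Qed.

Lemma tens_rexactl N' N N'' M (p : bimorphism N' N) (q : bimorphism N N'') :
  (forall c, exists b, q b = c) -> (forall b, q b = 0 -> exists a, p a = b) ->
  forall z, tmap q (lid M) z = 0 -> exists w, tmap p (lid M) w = z.
Proof.
move=> q_surj pq z /tmap_ker zI; apply/span_image/zI => //.
  by move=> m; exists m.
move=> n n' m m' qn mm'; have {mm'}<- : m = m' := mm'.
apply: span_gen.
have [|a an] := pq (n - n'); first by rewrite linearB qn subrr.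
by exists (tpure a m); rewrite /= tmap_pure an tpureDl tpureNl.
Qed.
End TensorMaps.

(** The map g factors through its coimage B / ker g, which embeds in C, and a
    flat module preserves this embedding. *)
Lemma flat_exact (R : pzRingType) (F : right_module R) : flat F ->
  forall (A B C : lmodType R) (f : {linear A -> B}) (g : {linear B -> C}),
  (forall b, g b = 0 -> exists a, f a = b) ->
  forall z, tmap (biid F) g z = 0 -> exists w, tmap (biid F) f w = z.
Proof.
move=> F_flat A B C f g fg z gz.
pose K := [set b | g b = 0]%classic.
have gK b : K b -> g b = 0 by [].
pose h : {linear quomod K -> C} := qlift gK.
have hE b : h (qpi K b) = g b := qlift_pi gK b.
have h_inj : injective h.
  apply: linear_inj => q; rewrite -[q]qpi_repr hE => hq.
  by rewrite -(linear0 (qpi K)); apply/qpi_eq/span_gen; rewrite subr0.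
apply: (tens_rexact (g := qpi K)) => [q|b b0|].
- exact: qpi_surj.
- by apply: fg; rewrite -hE; apply: etrans (congr1 h b0) (linear0 h).
- apply: (F_flat _ _ _ h_inj).
  by rewrite (tmap_idcomp _ (g := g)) // gz tmap0.
Qed.

Lemma ract0 (S R : pzRingType) (N : bimodule S R) (n : N) : ract n 0 = 0.
Proof. by apply: (@addrI _ (ract n 0)); rewrite addr0 -ractDr addr0. Qed.

Section TensorFree.
Variables (S R : pzRingType) (X : choiceType).
Implicit Types N : bimodule S R.

(** The coordinates of N (x) R^(X) = N^(X). *)
Lemma tens_coord N :
  {c : X -> {additive tens N (free R X) -> N} |
    forall x n w, c x (tpure n w) = ract n (w x)}.
Proof.
suff W x : {f : {additive tens N (free R X) -> N} |
    forall n w, f (tpure n w) = ract n (w x)}.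
  by exists (fun x => sval (W x)) => x; exact: svalP (W x).
have [n n' w|n w w'|n r w|f fE] :=
  @tens_lift _ _ N (free R X) N (fun n w => ract n (w x)).
- exact: ractDl.
- exact: ractDr.
- by rewrite -ractM.
- by exists f.
Qed.

(** Free modules are flat. An element of N (x) R^(X) vanishes when all its
    coordinates do, and p commutes with coordinates. *)
Lemma tens_free_inj N N' (p : bimorphism N N') : injective p ->
  injective (tmap p (lid (free R X))).
Proof.
move=> p_inj; apply: linear_inj => z z0.
have [c cE] := tens_coord N; have [c' cE'] := tens_coord N'.
(* Letting t be any larger support makes the property stable under sums. *)
pose Q w := exists s : seq X, forall t, uniq t -> {subset s <= t} ->
  w = \sum_(x <- t) tpure (c x w) (fgen R x).
have QD w w' : Q w -> Q w' -> Q (w + w').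
  move=> [s IHs] [s' IHs']; exists (s ++ s') => t t_uniq st.
  rewrite [in LHS](IHs t) // => [|x xs]; last by rewrite st // mem_cat xs.
  rewrite [in LHS](IHs' t) // => [|x xs]; last by rewrite st // mem_cat xs orbT.
  rewrite -big_split /=; apply: eq_bigr => x _.
  by rewrite raddfD tpureDl.
have Q0 : Q 0.
  by exists [::] => t _ _; rewrite big1 // => x _; rewrite raddf0 tpure0l.
have [s sE] : Q z.
  elim/tens_ind: z {z0} => // n; elim/free_ind => [|a x w IHw].
    by rewrite tpure0r.
  rewrite tpureDr; apply: QD IHw; exists [:: x] => t t_uniq xt.
  have aE y : (a *: fgen R x) y = a * (y == x)%:R by [].
  rewrite (bigD1_seq x) //= ?xt ?inE // big1 => [|y /negPf yx].
    by rewrite cE aE eqxx mulr1 tpureM addr0.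
  by rewrite cE aE yx mulr0 ract0 tpure0l.
have cp x w : p (c x w) = c' x (tmap p (lid _) w).
  elim/tens_ind: w => [|n m|u v IHu IHv]; first by rewrite tmap0 !raddf0.
    by rewrite tmap_pure cE cE' bifunr.
  by rewrite tmapD [c x _]raddfD linearD IHu IHv raddfD.
rewrite (sE (undup s)) ?undup_uniq // => [|x]; last by rewrite mem_undup.
rewrite big1 // => x _.
suff -> : c x z = 0 by rewrite tpure0l.
by apply: p_inj; rewrite cp z0 linear0 raddf0.
Qed.
End TensorFree.

(** * Comodules in terms of a flat resolution of U *)
Lemma homology_span (R : pzRingType) (A B C : lmodType R)
    (f : {linear A -> B}) (g : {linear B -> C}) (x : kermod g) :
  span [set x : kermod g | exists a, f a = x :> B]%classic x ->
  exists a, f a = x :> B.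
Proof.
elim=> [//||a x1 x2 _ [b bE] _ [b' b'E]]; first by exists 0; rewrite linear0.
by exists (a *: b + b'); rewrite linearP bE b'E.
Qed.

Section HomologyClass.
Variables (R : pzRingType) (A B C : lmodType R).
Variables (f : {linear A -> B}) (g : {linear B -> C}).

Definition hpi : {linear kermod g -> homology f g} := qpi _.

Lemma hpi_surj q : exists x, hpi x = q.
Proof. exact: qpi_surj. Qed.

Lemma hpi_eq0 x : hpi x = 0 <-> exists a, f a = x :> B.
Proof.
split=> [x0|fx].
  by apply: homology_span; rewrite -[x]subr0; apply/qpi_eq; rewrite linear0.
by rewrite -(linear0 hpi); apply/qpi_eq/span_gen; rewrite subr0.
Qed.

Lemma hpi_eq x y : hpi x = hpi y <-> exists a, f a = (x : B) - (y : B).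
Proof.
have xyE : hpi x = hpi y <-> hpi (x - y) = 0.
  by rewrite linearB; split=> [->|/subr0_eq//]; apply: subrr.
by rewrite xyE; apply: hpi_eq0.
Qed.

Lemma homology_eq0 :
  is_zero (homology f g) <-> forall z, g z = 0 -> exists y, f y = z.
Proof.
split=> [h0 z /eqP gz|fg q].
  exact: (hpi_eq0 (Kermod gz)).1 (h0 _).
by have [k <-] := hpi_surj q; apply/hpi_eq0/fg/eqP/kermodP.
Qed.
End HomologyClass.

Section CanonicalResolution.
Variables (R : pzRingType) (M : lmodType R).

Lemma augm_gen m : augm M (fgen R m) = m.
Proof. exact: fext_gen. Qed.
Lemma augm_surj m : exists p, augm M p = m.
Proof. by exists (fgen R m); apply: augm_gen. Qed.

Lemma cover_ker (A B : lmodType R) (f : {linear A -> B}) p : f (cover f p) = 0.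
Proof.
elim/free_ind: p => [|a x z IHz]; first by rewrite !linear0.
rewrite linearP [X in f X]/= linearP IHz addr0.
have -> : cover f (fgen R x) = x :> A by exact: fext_gen.
by rewrite (eqP (kermodP x)) scaler0.
Qed.

Lemma cover_exact (A B : lmodType R) (f : {linear A -> B}) a :
  f a = 0 -> exists p, cover f p = a.
Proof. by move=> /eqP fa; exists (fgen R (Kermod fa)); apply: fext_gen. Qed.
End CanonicalResolution.

(** A flat resolution of length 1, as provided by flat dimension at most 1. *)
Record flat_resolution (R : pzRingType) (N : right_module R) := FlatResolution {
  res1 : right_module R;
  res0 : right_module R;
  resd : bimorphism res1 res0;
  resp : bimorphism res0 N;
  resd_inj : injective resd;
  res_exact : forall x, resp x = 0 <-> exists y, resd y = x;
  resp_surj : forall y, exists x, resp x = y;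
  flat_res0 : flat res0;
  flat_res1 : flat res1 }.

Section TorOfResolution.
Variables (R : pzRingType) (N : right_module R) (F : flat_resolution N).
Implicit Types M : lmodType R.

(** The sequence F1 (x) M -> F0 (x) M -> N (x) M given by the resolution; the
    first map is phi, the second rho. *)
Definition phi M : tens (res1 F) M -> tens (res0 F) M := tmap (resd F) (lid M).
Definition rho M : tens (res0 F) M -> tens N M := tmap (resp F) (lid M).

Lemma phi0 M : @phi M 0 = 0. Proof. exact: tmap0. Qed.
Lemma phiD M x y : @phi M (x + y) = phi x + phi y. Proof. exact: tmapD. Qed.
Lemma rhoD M x y : @rho M (x + y) = rho x + rho y. Proof. exact: tmapD. Qed.
Lemma phiB M x y : @phi M (x - y) = phi x - phi y. Proof. exact: tmapB. Qed.
Lemma rhoB M x y : @rho M (x - y) = rho x - rho y. Proof. exact: tmapB. Qed.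

Lemma rho_phi M z : rho (@phi M z) = 0.
Proof.
elim/tens_ind: z => [|n m|x y IHx IHy]; first by rewrite /rho /phi !tmap0.
  rewrite /rho /phi !tmap_pure.
  have /res_exact -> : exists y, resd F y = resd F n by exists n.
  by rewrite tpure0l.
by rewrite phiD rhoD IHx IHy addr0.
Qed.

Lemma rho_exact M z : @rho M z = 0 -> exists w, phi w = z.
Proof.
by apply: tens_rexactl => [y|y]; [apply: resp_surj | move/res_exact].
Qed.

Lemma rho_surj M z : exists w, @rho M w = z.
Proof. by apply: tmap_surj; [apply: resp_surj | move=> m; exists m]. Qed.

Lemma phi_nat M M' (h : {linear M -> M'}) z :
  phi (tmap (biid _) h z) = tmap (biid _) h (phi z).
Proof. exact: tmap_swap. Qed.
Lemma rho_nat M M' (h : {linear M -> M'}) z :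
  rho (tmap (biid _) h z) = tmap (biid _) h (rho z).
Proof. exact: tmap_swap. Qed.

Lemma tens_eq0_phi M : is_zero (tens N M) <-> forall z, exists w, @phi M w = z.
Proof.
split=> [N0 z|phi_surj z]; first exact/rho_exact/N0.
by have [w <-] := rho_surj z; have [v <-] := phi_surj w; apply: rho_phi.
Qed.

(** Both conditions compute the same Tor group. The chase goes through the
    double complex F_i (x) P_j, where P is the free resolution of M: its columns
    F_i (x) P are exact because F_i is flat, and its rows because P_j is
    free. *)
Lemma Tor1_eq0_phi M : is_zero (Tor1 N M) <-> forall z, @phi M z = 0 -> z = 0.
Proof.
rewrite homology_eq0.
have augm0 (K : right_module R) z :
    tmap (biid K) (augm M) (tmap (biid K) (d1 M) z) = 0.
  rewrite (tmap_idcomp _ (g := lzero _ _)) ?tmap_zero //.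
  by move=> p; apply: cover_ker.
have dd0 (K : right_module R) z :
    tmap (biid K) (d1 M) (tmap (biid K) (d2 M) z) = 0.
  rewrite (tmap_idcomp _ (g := lzero _ _)) ?tmap_zero //.
  by move=> p; apply: cover_ker.
have surj (K : right_module R) z : exists w, tmap (biid K) (augm M) w = z.
  by apply: tmap_surj; [move=> n; exists n | apply: augm_surj].
have exact0 (K : right_module R) z : tmap (biid K) (augm M) z = 0 ->
    exists w, tmap (biid K) (d1 M) w = z.
  by apply: tens_rexact; [apply: augm_surj | apply: cover_exact].
split=> [Tor0 a|phi_inj z dz].
  (* a lifts to w in F1 (x) P0, which is shown to be a boundary. *)
  have [w <-] := surj _ a; rewrite phi_nat => /exact0[v vE].
  have [|y yE] := Tor0 (rho v); first by rewrite /= -rho_nat vE rho_phi.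
  have [y' y'E] := rho_surj y.
  have [|t tE] := @rho_exact _ (v - tmap (biid _) (d2 M) y').
    by rewrite rhoB rho_nat y'E [X in _ - X]yE subrr.
  suff -> : w = tmap (biid _) (d1 M) t by apply: augm0.
  apply: (tens_free_inj (p := resd F)); first exact: resd_inj.
  by rewrite -/(phi _) -[RHS]/(phi _) phi_nat tE tmapB dd0 subr0 vE.
(* v in F0 (x) P1 lifts the cycle z; it is corrected to a cycle by phi t. *)
have [v vE] := rho_surj z.
have [|w wE] := @rho_exact _ (tmap (biid _) (d1 M) v).
  by rewrite rho_nat vE.
have [|t tE] := exact0 _ w.
  by apply: phi_inj; rewrite phi_nat wE augm0.
have [||y yE] := @flat_exact _ _ (@flat_res0 _ _ F) _ _ _ (d2 M) (d1 M) _
  (v - phi t).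
- by move=> p; apply: cover_exact.
- by rewrite tmapB -phi_nat tE wE subrr.
exists (rho y); rewrite /= -rho_nat yE rhoB vE rho_phi subr0 //.
Qed.
End TorOfResolution.

(** The tensor product with the R-R-bimodule U and that with the right module U
    have the same elements, but are different quotients. *)
Section Comparison.
Variables (R U : pzRingType) (u : {rmorphism R -> U}).
Local Notation Ub := (restr_bimodule u).
Local Notation Ur := (restr_right u).
Implicit Types A B D M : lmodType R.

Lemma tens_right_spec M :
  {c : {additive tens Ub M -> tens Ur M} |
    (forall x m, c (tpure x m) = tpure (x : Ur) m) & bijective c}.
Proof.
have [x y m|x m m'|x r m|c cE] :=
  @tens_lift _ _ Ub M (tens Ur M) (fun x m => tpure (x : Ur) m).
- exact: (@tpureDl _ _ Ur).
- exact: (@tpureDr _ _ Ur).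
- exact: (@tpureM _ _ Ur).
have [x y m|x m m'|x r m|c' c'E] :=
  @tens_lift _ _ Ur M (tens Ub M) (fun x m => tpure (x : Ub) m).
- exact: (@tpureDl _ _ Ub).
- exact: (@tpureDr _ _ Ub).
- exact: (@tpureM _ _ Ub).
exists c => //; exists c'; elim/tens_ind => [|n m|x y IHx IHy].
all: by rewrite ?raddf0 ?raddfD ?cE ?c'E ?cE ?IHx ?IHy.
Qed.

Definition tens_right M : {additive tens Ub M -> tens Ur M} :=
  s2val (tens_right_spec M).

Lemma tens_right_pure M x m : tens_right M (tpure x m) = tpure (x : Ur) m.
Proof. exact: (s2valP (tens_right_spec M)). Qed.

Lemma tens_right_bij M : bijective (tens_right M).
Proof. exact: (s2valP' (tens_right_spec M)). Qed.

Lemma tens_right_inj M : injective (tens_right M).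
Proof. exact/bij_inj/tens_right_bij. Qed.

Lemma tens_right_surj M z : exists w, tens_right M w = z.
Proof. by have [c _ cK] := tens_right_bij M; exists (c z); apply: cK. Qed.

Lemma tens_right_nat M M' (h : {linear M -> M'}) z :
  tens_right M' (tmap (biid Ub) h z) = tmap (biid Ur) h (tens_right M z).
Proof.
elim/tens_ind: z => [|n m|x y IHx IHy]; first by rewrite tmap0 !raddf0.
  by rewrite tmap_pure !tens_right_pure tmap_pure.
by rewrite tmapD [LHS]raddfD IHx IHy -tmapD -raddfD.
Qed.

Lemma tens_right_eq0 M z : (tens_right M z = 0) <-> z = 0.
Proof.
split=> [|->]; last exact: raddf0.
by rewrite -(raddf0 (tens_right M)) => /tens_right_inj.
Qed.

Lemma tens_right_is_zero M :
  is_zero (tens Ub M) <-> is_zero (tens Ur M).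
Proof.
split=> z0 z; last exact/tens_right_eq0/z0.
by have [w <-] := tens_right_surj z; rewrite (z0 w) raddf0.
Qed.

Lemma tens_right_exact A B D (f : {linear A -> B}) (g : {linear B -> D}) :
  (forall z, tmap (biid Ub) g z = 0 -> exists y, tmap (biid Ub) f y = z) <->
  (forall z, tmap (biid Ur) g z = 0 -> exists y, tmap (biid Ur) f y = z).
Proof.
split=> ex z gz.
  have [w wz] := tens_right_surj z.
  have [|y yw] := ex w; last first.
    by exists (tens_right _ y); rewrite -tens_right_nat yw.
  by apply/tens_right_eq0; rewrite tens_right_nat wz.
have [|y yz] := ex (tens_right _ z).
  by rewrite -tens_right_nat; apply/tens_right_eq0.
have [w wy] := tens_right_surj y; exists w.
by apply: tens_right_inj; rewrite tens_right_nat wy.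
Qed.

Lemma tens_right_Tor1 M : is_zero (Tor1 Ub M) <-> is_zero (Tor1 Ur M).
Proof. by rewrite !homology_eq0; apply: tens_right_exact. Qed.

(** The form in which the comodule condition is used from here on. *)
Lemma comodule_phi (F : flat_resolution Ur) M :
  comodule u M <-> (forall z, @phi _ _ F M z = 0 -> z = 0) /\
                   (forall z, exists w, @phi _ _ F M w = z).
Proof.
have [T0 T0'] := tens_eq0_phi F M; have [T1 T1'] := Tor1_eq0_phi F M.
have [c0 c0'] := tens_right_is_zero M; have [c1 c1'] := tens_right_Tor1 M.
by split=> -[]; split; auto.
Qed.
End Comparison.

(** * Closure properties of comodules *)
Section ColimitTensor.
Variables (R : pzRingType) (N : right_module R) (V : zmodType).

Section Curry.
Variables (M : lmodType R) (g : tens N M -> V).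
Hypothesis gD : {morph g : x y / x + y}.

Fact curry_coindD m (x y : N) :
  g (tpure (x + y) m) = g (tpure x m) + g (tpure y m).
Proof. by rewrite tpureDl gD. Qed.
Definition curry_fun m : coind N V := Coind (curry_coindD m).
Fact curry_is_linear : linear curry_fun.
Proof.
by move=> a m m'; apply: coind_ext => n /=; rewrite tpureDr gD -tpureM.
Qed.
Definition curry : {linear M -> coind N V} := pack_linear curry_is_linear.
End Curry.

Lemma uncurry (M : lmodType R) (h : {linear M -> coind N V}) :
  {g : {additive tens N M -> V} | forall n m, g (tpure n m) = h m n}.
Proof.
apply: (@tens_lift _ _ N M V (fun n m => h m n)) => [n n' m|n m m'|n r m].
- exact: coindD.
- by rewrite linearD.
- by rewrite linearZ.
Qed.

Section Colimit.
Variables (I : small_category) (D : diagram I (module_category R)).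
Variables (L : lmodType R) (t : forall i, {linear D i -> L}).
Hypothesis t_colim : @is_colimit (module_category R) I D L t.

Lemma colimit_ext (X : lmodType R) (h h' : {linear L -> X}) :
  (forall i x, h (t i x) = h' (t i x)) -> h = h'.
Proof.
move=> hh'; have [tC /(_ X (fun i => lcomp h (t i)))] := t_colim.
case=> [i j f|k [_ k_uniq]].
  by apply: linear_ext => x /=; rewrite -[t i](tC i j f).
rewrite -(k_uniq h) // -(k_uniq h') // => i.
by apply: linear_ext => x; apply: esym; apply: hh'.
Qed.

Lemma colimit_tens_ext (g g' : {additive tens N L -> V}) :
  (forall i z, g (tmap (biid N) (t i) z) = g' (tmap (biid N) (t i) z)) ->
  g =1 g'.
Proof.
move=> gg'; apply: tens_additive_eq => n m.
suff : curry (raddfD g) = curry (raddfD g').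
  by move=> /(congr1 (fun h : {linear L -> coind N V} => h m n)).
apply: colimit_ext => i x; apply: coind_ext => k /=.
by have := gg' i (tpure k x); rewrite tmap_pure.
Qed.

(** N (x) L is the colimit of the N (x) D i: by adjunction, a cocone of additive
    maps out of the N (x) D i is a cocone of linear maps D i -> coind N V. *)
Lemma colimit_tens_lift (s : forall i, {additive tens N (D i) -> V}) :
  (forall i j (f : shom i j) z, s j (tmap (biid N) (dmap D f) z) = s i z) ->
  {g : {additive tens N L -> V} |
    forall i z, g (tmap (biid N) (t i) z) = s i z}.
Proof.
move=> sC; pose c i := curry (raddfD (s i)).
have cC : @cocone (module_category R) I D (coind N V) c.
  move=> i j f; apply: linear_ext => x; apply: coind_ext => n /=.
  by rewrite -(sC i j f) tmap_pure.
have [_ /(_ (coind N V) c cC)/cid[h [hE _]]] := t_colim.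
have [g gE] := uncurry h; exists g => i.
elim/tens_ind => [|n m|x y IHx IHy]; first by rewrite tmap0 !raddf0.
  by rewrite tmap_pure gE -[h _]/((h \c t i) m) hE.
by rewrite tmapD !raddfD IHx IHy.
Qed.
End Colimit.
End ColimitTensor.

Section Closure.
Variables (R U : pzRingType) (u : {rmorphism R -> U}).
Variable F : flat_resolution (restr_right u).
Implicit Types K A B C M : lmodType R.
Local Notation comodule := (comodule u).

Lemma comodule_inj M : comodule M -> forall z, @phi _ _ F M z = 0 -> z = 0.
Proof. by case/(comodule_phi F). Qed.
Lemma comodule_surj M : comodule M -> forall z, exists w, @phi _ _ F M w = z.
Proof. by case/(comodule_phi F). Qed.

(** The five lemma for phi on 0 -> K -> A -> B, whose rows stay exact after
    tensoring with the flat modules F1 and F0. *)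
Lemma comodule_left_exact K A B (i : {linear K -> A}) (f : {linear A -> B}) :
  injective i -> (forall a, f a = 0 <-> exists k, i k = a) ->
  comodule A -> (forall z, @phi _ _ F B z = 0 -> z = 0) -> comodule K.
Proof.
move=> i_inj fi coA Binj; apply/(comodule_phi F); split=> z.
  move=> z0; apply: (flat_res1 i_inj); rewrite [RHS]tmap0.
  by apply: (comodule_inj coA); rewrite phi_nat z0 tmap0.
have [w wz] := comodule_surj coA (tmap (biid _) i z).
have [||v vw] := @flat_exact _ _ (@flat_res1 _ _ F) _ _ _ i f _ w.
- by move=> a /fi.
- apply: Binj; rewrite phi_nat wz (tmap_idcomp _ (g := lzero _ _)).
    by rewrite tmap_zero.
  by move=> k; apply/fi; exists k.
by exists v; apply: (flat_res0 i_inj); rewrite -phi_nat vw.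
Qed.

(** The five lemma for phi on A -> B -> C -> 0. *)
Lemma comodule_right_exact A B C (f : {linear A -> B}) (p : {linear B -> C}) :
  (forall c, exists b, p b = c) -> (forall b, p b = 0 <-> exists a, f a = b) ->
  comodule A -> comodule B -> comodule C.
Proof.
move=> p_surj pf coA coB.
have psurj (K : right_module R) z : exists w, tmap (biid K) p w = z.
  by apply: tmap_surj; [move=> n; exists n | apply: p_surj].
apply/(comodule_phi F); split=> z.
  have [w <-] := psurj _ z; rewrite phi_nat => w0.
  have [||v vw] := @tens_rexact _ _ _ _ _ _ f p _ _ _ w0 => //.
    by move=> b /pf.
  have [v' v'v] := comodule_surj coA v.
  suff -> : w = tmap (biid _) f v'.
    rewrite (tmap_idcomp _ (g := lzero _ _)) ?tmap_zero //.
    by move=> a; apply/pf; exists a.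
  apply/subr0_eq/(comodule_inj coB).
  by rewrite phiB phi_nat v'v vw subrr.
have [w <-] := psurj _ z; have [v <-] := comodule_surj coB w.
by exists (tmap (biid _) p v); rewrite phi_nat.
Qed.

Lemma comodule_zero A : is_zero A -> comodule A.
Proof.
move=> A0; have t0 (K : right_module R) (z : tens K A) : z = 0.
  by rewrite -(tmap_id (f := lid A) _ z) // tmap_zero.
apply/(comodule_phi F); split=> z; rewrite ?(t0 _ z) //.
by exists 0; rewrite phi0.
Qed.

Lemma tens_pair A B :
  exists (i : {linear A -> (A * B)%type}) (j : {linear B -> (A * B)%type})
    (q : {linear (A * B)%type -> A}) (r : {linear (A * B)%type -> B}),
  forall (K : right_module R) z,
    z = tmap (biid K) i (tmap (biid K) q z) +
        tmap (biid K) j (tmap (biid K) r z).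
Proof.
have iL : linear (fun x : A => (x, 0 : B)).
  by move=> a x y; congr (_, _); rewrite /= scaler0 addr0.
have jL : linear (fun y : B => (0 : A, y)).
  by move=> a x y; congr (_, _); rewrite /= scaler0 addr0.
have qL : linear (fun z : A * B => z.1) by [].
have rL : linear (fun z : A * B => z.2) by [].
exists (pack_linear iL), (pack_linear jL), (pack_linear qL), (pack_linear rL).
move=> K z.
elim/tens_ind: z => [|n [x y]|x y IHx IHy]; first by rewrite !tmap0 addr0.
    by rewrite !tmap_pure -tpureDr; congr tpure; congr (_, _);
       rewrite /= ?addr0 ?add0r.
  rewrite !tmapD addrACA; congr (_ + _); [exact: IHx | exact: IHy].
Qed.

Lemma phi_prod_inj A B :
  (forall z, @phi _ _ F A z = 0 -> z = 0) ->
  (forall z, @phi _ _ F B z = 0 -> z = 0) ->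
  forall z, @phi _ _ F (A * B)%type z = 0 -> z = 0.
Proof.
move=> A_inj B_inj z z0; have [i [j [q [r ijqr]]]] := tens_pair A B.
have qz0 : tmap (biid _) q z = 0 by apply: A_inj; rewrite phi_nat z0 tmap0.
have rz0 : tmap (biid _) r z = 0 by apply: B_inj; rewrite phi_nat z0 tmap0.
by apply: etrans (ijqr _ z) _; rewrite qz0 rz0 !tmap0 addr0.
Qed.

Lemma comodule_prod A B : comodule A -> comodule B -> comodule (A * B)%type.
Proof.
move=> coA coB; apply/(comodule_phi F); split=> z.
  by apply: phi_prod_inj; apply: comodule_inj.
have [i [j [q [r ijqr]]]] := tens_pair A B.
have [v vE] := comodule_surj coA (tmap (biid _) q z).
have [w wE] := comodule_surj coB (tmap (biid _) r z).
exists (tmap (biid _) i v + tmap (biid _) j w).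
by rewrite phiD !phi_nat vE wE; apply/esym/ijqr.
Qed.

(** On L, the inverse of phi is glued from the inverses of phi on the D i,
    since F0 (x) L is the colimit of the F0 (x) D i. *)
Lemma comodule_colimit (I : small_category)
    (D : diagram I (module_category R)) (L : lmodType R)
    (t : forall i, {linear D i -> L}) :
  @is_colimit (module_category R) I D L t ->
  (forall i, comodule (D i)) -> comodule L.
Proof.
move=> tL coD.
have /(_ _)/choice W i := comodule_surj (coD i).
pose w i := projT1 (W i).
have wK i z : phi (w i z) = z := projT2 (W i) z.
have Kw i z : w i (phi z) = z.
  by apply/subr0_eq/(comodule_inj (coD i)); rewrite phiB wK subrr.
have wD i : zmod_morphism (fun z => tmap (biid _) (t i) (w i z)).
  move=> x y; rewrite -tmapB; congr tmap.
  by rewrite -[LHS]Kw -[RHS]Kw; congr w; rewrite phiB !wK.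
pose s i := pack_additive (wD i).
have tC : @cocone (module_category R) I D L t by case: tL.
have sC i j (f : shom i j) z : s j (tmap (biid _) (dmap D f) z) = s i z.
  rewrite /s /= -[z]wK -phi_nat !Kw.
  by apply: tmap_idcomp => x; rewrite -[in RHS](tC i j f).
have [g gE] := colimit_tens_lift tL sC.
pose gphi : {additive tens (res1 F) L -> tens (res1 F) L} :=
  g \o tmap (resd F) (lid L).
pose phig : {additive tens (res0 F) L -> tens (res0 F) L} :=
  tmap (resd F) (lid L) \o g.
have gphiE : gphi =1 idfun.
  apply: (colimit_tens_ext tL (g' := idfun)) => i z.
  by rewrite /gphi /= -/(phi _) phi_nat gE /s /= Kw.
have phigE : phig =1 idfun.
  apply: (colimit_tens_ext tL (g' := idfun)) => i z.
  by rewrite /phig /= -/(phi _) gE /s /= phi_nat wK.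
apply/(comodule_phi F); split=> z; last by exists (g z); apply: phigE.
by move=> z0; rewrite -[z]gphiE /gphi /= -/(phi _) z0 raddf0.
Qed.
End Closure.

(** * The abelian category of comodules *)
Section LinearFactor.
Variables (R : pzRingType) (A B C : lmodType R).

Lemma linear_lift (i : {linear A -> B}) (g : {linear C -> B}) :
  injective i -> (forall x, exists a, i a = g x) ->
  exists h : {linear C -> A}, forall x, i (h x) = g x.
Proof.
move=> i_inj /choice[h hE].
have hL : linear h by move=> a x y; apply: i_inj; rewrite linearP !hE linearP.
by exists (pack_linear hL).
Qed.

Lemma linear_desc (p : {linear A -> B}) (g : {linear A -> C}) :
  (forall b, exists a, p a = b) -> (forall a, p a = 0 -> g a = 0) ->
  exists h : {linear B -> C}, forall a, h (p a) = g a.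
Proof.
move=> /choice[s sK] pg.
have gE a a' : p a = p a' -> g a = g a'.
  by move=> aa; apply/subr0_eq; rewrite -linearB pg // linearB aa subrr.
have hL : linear (fun b => g (s b)).
  by move=> a x y; rewrite -linearP; apply: gE; rewrite linearP !sK.
by exists (pack_linear hL) => a; apply: gE; rewrite sK.
Qed.
End LinearFactor.

Section KernelInclusion.
Variables (R : pzRingType) (A B : lmodType R) (f : {linear A -> B}).
Fact kerval_is_linear : linear (fun k : kermod f => k : A). Proof. by []. Qed.
Definition kerval : {linear kermod f -> A} := pack_linear kerval_is_linear.
Lemma kerval_inj : injective kerval. Proof. exact: val_inj. Qed.
Lemma kerval_exact a : f a = 0 <-> exists k, kerval k = a.
Proof.
split=> [/eqP fa|[k <-]]; first by exists (Kermod fa).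
exact/eqP/(kermodP k).
Qed.
Definition coker : lmodType R := quomod [set b | exists a, f a = b]%classic.
Definition cokerpi : {linear B -> coker} := qpi _.
Lemma cokerpi_surj q : exists b, cokerpi b = q. Proof. exact: qpi_surj. Qed.
Lemma cokerpi_exact b : cokerpi b = 0 <-> exists a, f a = b.
Proof.
split=> [b0|[a fa]].
  apply: span_image; rewrite -[b]subr0; apply/qpi_eq.
  by rewrite linear0; apply: b0.
rewrite -(linear0 cokerpi); apply/qpi_eq/span_gen; rewrite subr0.
by exists a.
Qed.
End KernelInclusion.

Section ComoduleCategory.
Variables (R U : pzRingType) (u : {rmorphism R -> U}).
Variable F : flat_resolution (restr_right u).
Local Notation C := (comodule_category u).
Local Notation comodule := (comodule u).
Implicit Types M : lmodType R.

Definition carrier (a : C) : lmodType R := sval a.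
Definition cofun (a b : C) (f : hom a b) : {linear carrier a -> carrier b} := f.
Definition cobj M (coM : comodule M) : C := exist comodule M coM.

Lemma carrierP (a : C) : comodule (carrier a). Proof. exact: svalP a. Qed.

Lemma cofun_inj (a b : C) (f g : hom a b) : cofun f =1 cofun g -> f = g.
Proof. exact: linear_ext. Qed.

Lemma cofun_eq (a b : C) (f g : hom a b) : f = g -> cofun f =1 cofun g.
Proof. by move->. Qed.

Lemma cofunE (a b c : C) (g : hom b c) (f : hom a b) x :
  cofun (g \c f) x = cofun g (cofun f x).
Proof. by []. Qed.

Lemma cofun0 (a b : C) x : cofun (0 : hom a b) x = 0. Proof. by []. Qed.

Lemma comodule_ker (a b : C) (f : hom a b) : comodule (kermod (cofun f)).
Proof.
apply: (@comodule_left_exact _ _ _ F _ _ _ (kerval (cofun f)) (cofun f)).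
- exact: kerval_inj.
- exact: kerval_exact.
- exact: carrierP.
- exact/comodule_inj/carrierP.
Qed.

Lemma comodule_coker (a b : C) (f : hom a b) : comodule (coker (cofun f)).
Proof.
apply: (@comodule_right_exact _ _ _ F _ _ _ (cofun f) (cokerpi (cofun f))).
- exact: cokerpi_surj.
- exact: cokerpi_exact.
- exact: carrierP.
- exact: carrierP.
Qed.

Definition cker (a b : C) (f : hom a b) : C := cobj (comodule_ker f).
Definition ccoker (a b : C) (f : hom a b) : C := cobj (comodule_coker f).
Definition ckerval (a b : C) (f : hom a b) : hom (cker f) a := kerval (cofun f).
Definition ccokerpi (a b : C) (f : hom a b) : hom b (ccoker f) :=
  cokerpi (cofun f).

(** The kernel as a module is again a comodule, hence a test object for
    monomorphisms. *)
Lemma monoP (a b : C) (f : hom a b) : mono f <-> injective (cofun f).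
Proof.
split=> [f_mono|f_inj x g h fgh].
  apply: linear_inj => x /kerval_exact[k <-].
  suff k0 : ckerval f = 0 by exact: (cofun_eq k0 k).
  apply: f_mono; apply: cofun_inj => y; rewrite !cofunE cofun0 linear0.
  by apply/kerval_exact; exists y.
apply: cofun_inj => y; apply: f_inj.
exact: (cofun_eq fgh y).
Qed.

(** Dually, the cokernel of f as a module is a comodule on which the projection
    and 0 agree after f. *)
Lemma epiP (a b : C) (f : hom a b) :
  epi f <-> (forall y, exists x, cofun f x = y).
Proof.
split=> [f_epi y|f_surj x g h fgh].
  apply/cokerpi_exact.
  suff p0 : ccokerpi f = 0 by exact: (cofun_eq p0 y).
  apply: f_epi; apply: cofun_inj => x; rewrite !cofunE cofun0.
  by apply/cokerpi_exact; exists x.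
apply: cofun_inj => y; have [z <-] := f_surj y.
exact: (cofun_eq fgh z).
Qed.

(** Kernels of comodules are kernels of modules. With its analogue for cokernels
    this says that the embedding into modules is exact and reflects
    exactness. *)
Lemma is_kernelP (k a b : C) (i : hom k a) (f : hom a b) :
  is_kernel i f <->
  injective (cofun i) /\
  (forall y, cofun f y = 0 <-> exists x, cofun i x = y).
Proof.
split=> [[fi0 i_univ]|[i_inj i_exact]].
  have i_mono : mono i.
    move=> x g h gh; have [|h0 [_ h0_uniq]] := i_univ x (i \c g).
      by rewrite compA fi0; apply: cofun_inj.
    by rewrite -(h0_uniq g) // -(h0_uniq h).
  split=> [|y]; first exact/monoP.
  split=> [/kerval_exact[z <-]|[x <-]]; last exact: (cofun_eq fi0 x).
  have [|h [hE _]] := i_univ (cker f) (ckerval f).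
    by apply: cofun_inj => w; apply/(kerval_exact (cofun f)); exists w.
  by exists (cofun h z); apply: (cofun_eq hE z).
split=> [|x g fg0].
  by apply: cofun_inj => x; rewrite cofunE cofun0; apply/i_exact; exists x.
have [h hE] : exists h : {linear carrier x -> carrier k},
    forall y, cofun i (h y) = cofun g y.
  apply: linear_lift => // y; apply/i_exact.
  exact: (cofun_eq fg0 y).
exists h; split=> [|h' h'E]; first exact: cofun_inj.
apply: cofun_inj => y; apply: i_inj; apply: etrans (hE y) _.
exact: (esym (cofun_eq h'E y)).
Qed.

Lemma is_cokernelP (a b c : C) (p : hom b c) (f : hom a b) :
  is_cokernel p f <->
  (forall z, exists y, cofun p y = z) /\
  (forall y, cofun p y = 0 <-> exists x, cofun f x = y).
Proof.
split=> [[pf0 p_univ]|[p_surj p_exact]].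
  have p_epi : epi p.
    move=> x g h gh; have [|h0 [_ h0_uniq]] := p_univ x (g \c p).
      by rewrite -compA pf0; apply: cofun_inj => y; apply: linear0.
    by rewrite -(h0_uniq g) // -(h0_uniq h).
  split=> [|y]; first exact/epiP.
  split=> [py|[x <-]]; last exact: (cofun_eq pf0 x).
  have [|h [hE _]] := p_univ (ccoker f) (ccokerpi f).
    by apply: cofun_inj => w; apply/(cokerpi_exact (cofun f)); exists w.
  apply/cokerpi_exact; rewrite -[LHS](cofun_eq hE y) cofunE py.
  exact: linear0.
split=> [|x g gf0].
  by apply: cofun_inj => x; rewrite cofunE cofun0; apply/p_exact; exists x.
have [h hE] : exists h : {linear carrier c -> carrier x},
    forall y, h (cofun p y) = cofun g y.
  apply: linear_desc => // y /p_exact[z <-].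
  exact: (cofun_eq gf0 z).
exists h; split=> [|h' h'E]; first exact: cofun_inj.
apply: cofun_inj => z; have [y <-] := p_surj z; apply: etrans (hE y) _.
exact: (esym (cofun_eq h'E y)).
Qed.

Lemma ckerP (a b : C) (f : hom a b) : is_kernel (ckerval f) f.
Proof.
by apply/is_kernelP; split; [apply: kerval_inj | apply: kerval_exact].
Qed.

Lemma ccokerP (a b : C) (f : hom a b) : is_cokernel (ccokerpi f) f.
Proof.
by apply/is_cokernelP; split; [apply: cokerpi_surj | apply: cokerpi_exact].
Qed.

Lemma comodule_abelian : abelian C.
Proof.
split.
- have z0 : is_zero (kermod (lid R^o)).
    by move=> x; apply/val_inj/eqP/(kermodP x).
  exists (cobj (comodule_zero F z0)) => a; split=> f; apply: cofun_inj => x.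
    by rewrite [x]z0 linear0.
  exact: z0.
- move=> a b; exists (cobj (comodule_prod F (carrierP a) (carrierP b))).
  have iL : linear (fun x : carrier a => (x, 0 : carrier b)).
    by move=> r x y; congr (_, _); rewrite /= scaler0 addr0.
  have jL : linear (fun y : carrier b => (0 : carrier a, y)).
    by move=> r x y; congr (_, _); rewrite /= scaler0 addr0.
  have qL : linear (fun z : carrier a * carrier b => z.1) by [].
  have rL : linear (fun z : carrier a * carrier b => z.2) by [].
  exists (pack_linear iL), (pack_linear jL), (pack_linear qL), (pack_linear rL).
  split; apply: cofun_inj => //= -[x y]; congr (_, _) => /=.
    exact: addr0.
  exact: add0r.
- by move=> a b f; exists (cker f), (ckerval f); apply: ckerP.
- by move=> a b f; exists (ccoker f), (ccokerpi f); apply: ccokerP.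
- move=> a b f /monoP f_inj; exists (ccoker f), (ccokerpi f).
  by apply/is_kernelP; split=> // y; apply: cokerpi_exact.
- move=> a b f /epiP f_surj; exists (cker f), (ckerval f).
  by apply/is_cokernelP; split=> // y; apply: kerval_exact.
Qed.
End ComoduleCategory.

(** * Colimits, and exactness of filtered colimits *)
Section ModuleColimit.
Variables (R : pzRingType) (I : small_category).
Variable D : diagram I (module_category R).
Local Notation Dm i := (D i : lmodType R).
Let germ : choiceType := {i : I & Dm i}.
Let gen i (x : Dm i) : free R germ := fgen R (Tagged (fun i => Dm i) x).
Let Dmap i j (f : shom i j) : {linear Dm i -> Dm j} := dmap D f.

Let Dmap1 i x : Dmap (sid i) x = x.
Proof. by rewrite /Dmap dmap1. Qed.
Let Dmapc i j k (g : shom j k) (f : shom i j) x :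
  Dmap (scomp g f) x = Dmap g (Dmap f x).
Proof. by rewrite /Dmap dmapc. Qed.

(** The colimit as the free module on pairs of an object i and an element of
    D i, modulo linearity in each D i and compatibility with the arrows. *)
Inductive colim_rel : set (free R germ) :=
| colim_lin i a (x y : Dm i) :
    colim_rel (gen (a *: x + y) - (a *: gen x + gen y))
| colim_map i j (f : shom i j) x : colim_rel (gen (Dmap f x) - gen x).

Definition colim : lmodType R := quomod colim_rel.
Definition colim_in_fun i (x : Dm i) : colim := qpi colim_rel (gen x).
Fact colim_in_is_linear i : linear (@colim_in_fun i).
Proof.
move=> a x y; rewrite /colim_in_fun -linearP.
by apply/qpi_eq/span_gen; apply: colim_lin.
Qed.
Definition colim_in i : {linear Dm i -> colim} :=
  pack_linear (@colim_in_is_linear i).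

Lemma colim_in_map i j (f : shom i j) x : colim_in j (Dmap f x) = colim_in i x.
Proof. by apply/qpi_eq/span_gen; apply: colim_map. Qed.

Lemma colim_ind (P : colim -> Prop) : P 0 ->
  (forall a i x y, P y -> P (a *: colim_in i x + y)) -> forall y, P y.
Proof.
move=> P0 PD y; have [z <-] := qpi_surj y.
elim/free_ind: z => [|a [i x] z IHz]; first by rewrite linear0.
by rewrite linearP; apply: PD.
Qed.

Lemma colimP : @is_colimit (module_category R) I D colim colim_in.
Proof.
split=> [i j f|X s sC]; first by apply: linear_ext => x; apply: colim_in_map.
pose L : {linear free R germ -> (X : lmodType R)} :=
  fext (fun p : germ =>
    (s (tag p) : {linear _ -> (X : lmodType R)}) (tagged p)).
have LE i x : L (gen x) = (s i : {linear Dm i -> (X : lmodType R)}) x.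
  exact: fext_gen.
have L0 z : colim_rel z -> L z = 0.
  case=> [i a x y|i j f x]; rewrite linearB ?[L (_ + gen y)]linearP !LE.
    by rewrite linearP subrr.
  by rewrite -(sC i j f) subrr.
pose H : {linear colim -> (X : lmodType R)} := qlift L0.
have HE z : H (qpi colim_rel z) = L z := qlift_pi L0 z.
have HsE i x : H (colim_in i x) = (s i : {linear Dm i -> (X : lmodType R)}) x.
  by rewrite -LE -HE.
exists H; split=> [i|h hE]; first exact/linear_ext/HsE.
apply: linear_ext; apply: colim_ind => [|a i x y IHy].
  by rewrite !linear0.
rewrite !linearP [in LHS]IHy; congr (a *: _ + _).
by rewrite -[RHS]/((h \c colim_in i) x) hE HsE.
Qed.

Section Filtered.
Hypothesis I_filt : filtered I.

Lemma colim_filtered_surj y : exists i x, colim_in i x = y.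
Proof.
elim/colim_ind: y => [|a i x _ [j [y <-]]].
  have [i _] := filt_ob I_filt.
  by exists i, 0; rewrite linear0.
have [k [[f _] [g _]]] := filt_join I_filt i j.
exists k, (a *: Dmap f x + Dmap g y).
by rewrite linearP !colim_in_map.
Qed.

Let arrow : choiceType := {ij : I * I & shom ij.1 ij.2}.
(** A partial cocone with vertex k. Only finitely many legs are ever needed, and
    in a filtered category only finitely many can be had at once. *)
Definition legs (k : I) := forall i : I, option (shom i k).
Definition commutes (k : I) (c : legs k) (a : arrow) := exists ci cj,
  [/\ c (tag a).1 = Some ci, c (tag a).2 = Some cj & scomp cj (tagged a) = ci].

Lemma legs_extend k (c : legs k) j : exists k' (c' : legs k'),
  [/\ forall a, commutes c a -> commutes c' a,
      forall i ci, c i = Some ci -> exists ci', c' i = Some ci' &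
      exists cj, c' j = Some cj].
Proof.
have [k' [[h _] [g _]]] := filt_join I_filt k j.
pose c' i : option (shom i k') :=
  if c i is Some ci then Some (scomp h ci) else
  if pselect (j = i) is left e then Some (eq_rect j (fun i => shom i k') g i e)
  else None.
exists k', c'; split=> [a [ci [cj [cE c'E aE]]]|i ci cE|].
- exists (scomp h ci), (scomp h cj); rewrite /c' cE c'E; split=> //.
  by rewrite -scompA aE.
- by exists (scomp h ci); rewrite /c' cE.
- rewrite /c'; case: (c j) => [cj|]; first by exists (scomp h cj).
  by case: pselect => // e; eexists.
Qed.

(** Finite diagrams in a filtered category have a cocone. For each arrow the two
    legs are first made to exist, and then equalized. *)
Lemma legs_exist (A : seq arrow) :
  exists k (c : legs k), forall a, a \in A -> commutes c a.
Proof.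
elim: A => [|[[i j] f] A [k [c cA]]].
  by have [k _] := filt_ob I_filt; exists k, (fun=> None).
have [k1 [c1 [cc1 _ [ci ciE]]]] := legs_extend c i.
have [k2 [c2 [cc2 c12 [cj cjE]]]] := legs_extend c1 j.
have [ci' ci'E] := c12 _ _ ciE.
have [k3 [h hE]] := filt_coeq I_filt ci' (scomp cj f).
exists k3, (fun l => if c2 l is Some cl then Some (scomp h cl) else None).
move=> a; rewrite inE => /predU1P[->|/cA/cc1/cc2[bi [bj [biE bjE bE]]]].
  exists (scomp h ci'), (scomp h cj) => /=; rewrite ci'E cjE; split=> //.
  by rewrite -scompA hE.
exists (scomp h bi), (scomp h bj); rewrite biE bjE; split=> //.
by rewrite -scompA bE.
Qed.

(** Transport of a formal sum of elements to the vertex of a partial cocone,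
    where the elements without a leg are dropped. *)
Definition legs_eval k (c : legs k) : {linear free R germ -> Dm k} :=
  fext (fun p : germ => if c (tag p) is Some f then Dmap f (tagged p) else 0).

Lemma legs_eval_gen k (c : legs k) i (x : Dm i) :
  legs_eval c (gen x) = if c i is Some f then Dmap f x else 0.
Proof. exact: fext_gen. Qed.

(** A given relation uses finitely many arrows, and holds at the vertex of any
    partial cocone that commutes with these. *)
Lemma colim_rel_eval z : span colim_rel z -> exists A : seq arrow,
  forall k (c : legs k), (forall a, a \in A -> commutes c a) ->
  legs_eval c z = 0.
Proof.
elim=> {z} [_ [i a x y|i j f x]||a z z' _ [A IHz] _ [A' IHz']].
- exists [::] => k c _; rewrite linearB [legs_eval c (_ + gen y)]linearP.
  rewrite !legs_eval_gen; case: (c i) => [f|]; first by rewrite linearP subrr.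
  by rewrite scaler0 addr0 subrr.
- pose fa : arrow :=
    Tagged (fun ij : I * I => shom ij.1 ij.2) (f : shom (i, j).1 (i, j).2).
  exists [:: fa] => k c /(_ fa (mem_head _ _))[ci [cj /= [ciE cjE fE]]].
  by rewrite -fE in ciE; rewrite linearB !legs_eval_gen ciE cjE Dmapc subrr.
- by exists [::] => k c _; rewrite linear0.
- exists (A ++ A') => k c cA; rewrite linearP IHz ?IHz' ?scaler0 ?addr0 //.
    by move=> b bA; apply: cA; rewrite mem_cat bA orbT.
  by move=> b bA; apply: cA; rewrite mem_cat bA.
Qed.

(** An element that vanishes in a filtered colimit vanishes at a later stage:
    the relation that kills it already holds at the vertex of a cocone over the
    finitely many arrows that it uses. *)
Lemma colim_filtered_eq0 i x : colim_in i x = 0 ->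
  exists j (f : shom i j), Dmap f x = 0.
Proof.
move=> x0; have [|A A0] := @colim_rel_eval (gen x).
  by rewrite -[gen x]subr0; apply/qpi_eq; rewrite linear0; apply: x0.
(* The identity arrow is added to force the leg at i to exist. *)
pose ia : arrow :=
  Tagged (fun ij : I * I => shom ij.1 ij.2) (sid i : shom (i, i).1 (i, i).2).
have [k [c cA]] := legs_exist (ia :: A).
have [ci [cj /= [ciE _ _]]] := cA ia (mem_head _ _).
exists k, ci; have := A0 k c; rewrite legs_eval_gen ciE; apply=> a aA.
by apply: cA; rewrite inE aA orbT.
Qed.
End Filtered.
End ModuleColimit.

Section ComoduleColimit.
Variables (R U : pzRingType) (u : {rmorphism R -> U}).
Variable F : flat_resolution (restr_right u).
Local Notation C := (comodule_category u).

Definition carrier_diagram (I : small_category) (D : diagram I C) :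
  diagram I (module_category R) :=
  @Diagram I (module_category R) (fun i => carrier (D i))
    (fun i j f => dmap D f)
    (fun i => dmap1 D i) (fun i j k g f => dmapc D g f).

Lemma comodule_colim (I : small_category) (D : diagram I C) :
  comodule u (colim (carrier_diagram D)).
Proof.
by apply: (comodule_colimit F (colimP _)) => i; apply: carrierP.
Qed.

Definition ccolim (I : small_category) (D : diagram I C) : C :=
  cobj (comodule_colim D).
Definition ccolim_in (I : small_category) (D : diagram I C) i :
  hom (D i) (ccolim D) := colim_in (carrier_diagram D) i.

Lemma ccolimP (I : small_category) (D : diagram I C) :
  is_colimit (@ccolim_in I D).
Proof.
have [cc univ] := colimP (carrier_diagram D).
split=> [i j f|x s sC]; first exact: (cc i j f).
exact: (univ (carrier x) s sC).
Qed.

Lemma comodule_cocomplete : cocomplete C.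
Proof. by move=> I D; exists (ccolim D), (@ccolim_in I D); apply: ccolimP. Qed.

(** All colimits of a diagram of comodules are isomorphic to the one computed
    for modules, so its elementwise description applies to them. *)
Lemma filtered_colimit_comodule (I : small_category) (D : diagram I C) (d : C)
    (t : forall i, hom (D i) d) : filtered I -> is_colimit t ->
  (forall y, exists i x, cofun (t i) x = y) /\
  (forall i x, cofun (t i) x = 0 ->
     exists j (f : shom i j), cofun (dmap D f) x = 0).
Proof.
move=> I_filt [tC t_univ].
have [cC c_univ] := ccolimP D.
have [a [aE _]] := t_univ _ _ cC.
have [b [bE _]] := c_univ _ _ tC.
have ba : b \c a = idc d.
  have [h [_ h_uniq]] := t_univ _ _ tC.
  rewrite -(h_uniq (b \c a)) => [|i]; last by rewrite -compA aE bE.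
  by apply: h_uniq => i; rewrite comp1c.
split=> [y|i x x0].
  have [i [x xE]] := colim_filtered_surj I_filt (cofun a y).
  exists i, x; rewrite -[RHS](cofun_eq ba y) cofunE -xE.
  exact: esym (cofun_eq (bE i) x).
apply: (@colim_filtered_eq0 _ _ (carrier_diagram D) I_filt i x).
apply: etrans (esym (cofun_eq (aE i) x)) _.
by rewrite cofunE x0; apply: linear0.
Qed.

Lemma comodule_AB5 : exact_filtered_colimits C.
Proof.
move=> I I_filt D E G f g f_nat g_nat fg d e c t s r tL sL rL f' g' f'E g'E.
have [t_surj t0] := filtered_colimit_comodule I_filt tL.
have [s_surj s0] := filtered_colimit_comodule I_filt sL.
have [r_surj r0] := filtered_colimit_comodule I_filt rL.
have [tC _] := tL; have [sC _] := sL.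
have f'E_ i x : cofun f' (cofun (t i) x) = cofun (s i) (cofun (f i) x).
  exact: (cofun_eq (f'E i) x).
have g'E_ i x : cofun g' (cofun (s i) x) = cofun (r i) (cofun (g i) x).
  exact: (cofun_eq (g'E i) x).
have f_inj i : injective (cofun (f i)).
  by have [/(is_kernelP F)[]] := fg i.
have f_exact i y : cofun (g i) y = 0 <-> exists x, cofun (f i) x = y.
  by have [/(is_kernelP F)[_]] := fg i.
have g_surj i z : exists y, cofun (g i) y = z.
  by have [_ /(is_cokernelP F)[]] := fg i.
have exact' y : cofun g' y = 0 <-> exists x, cofun f' x = y.
  split=> [|[x <-]].
    have [i [v <-]] := s_surj y; rewrite g'E_ => /r0[j [a aE]].
    have [|w wE] := (f_exact j (cofun (dmap E a) v)).1.
      by rewrite -aE; apply: (cofun_eq (g_nat i j a) v).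
    exists (cofun (t j) w); rewrite f'E_ wE; exact: (cofun_eq (sC i j a) v).
  have [i [w <-]] := t_surj x; rewrite f'E_ g'E_.
  have -> : cofun (g i) (cofun (f i) w) = 0 by apply/f_exact; exists w.
  exact: linear0.
have f'_inj : injective (cofun f').
  apply: linear_inj => x; have [i [w <-]] := t_surj x.
  rewrite f'E_ => /s0[j [a aE]].
  rewrite -[LHS](cofun_eq (tC i j a) w) cofunE.
  have -> : cofun (dmap D a) w = 0; last exact: linear0.
  apply: f_inj; rewrite linear0 -[RHS]aE.
  exact: (cofun_eq (f_nat i j a) w).
split; first by apply/(is_kernelP F).
apply/(is_cokernelP F); split=> // z.
have [i [w <-]] := r_surj z; have [v <-] := g_surj i w.
by exists (cofun (s i) v); apply: g'E_.
Qed.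
End ComoduleColimit.

(** * A generator *)
Section TensorLocal.
Variables (S R : pzRingType) (N : bimodule S R) (M : lmodType R).

(** A proof of n (x) y = 0 is a finite combination of relations, which mentions
    the finite list l of elements of M; it remains a proof over each submodule
    containing y and l. *)
Lemma tpure_eq0_local (n : N) (y : M) : tpure n y = 0 :> tens N M ->
  exists l : seq M, forall (K : lmodType R) (j : {linear K -> M}) (y0 : K),
    injective j -> j y0 = y -> (forall m, m \in l -> exists k, j k = m) ->
    tpure n y0 = 0 :> tens N K.
Proof.
(* G K q replaces each element m of M by q m, where q : M -> K is a left inverse
   of j, as a map of sets only. *)
move=> n0; pose G (K : lmodType R) (q : M -> K) :
  {linear free S (N * M)%type -> tens N K} := fext (fun p => tpure p.1 (q p.2)).
have GE (K : lmodType R) (q : M -> K) a b :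
    G K q (fgen S (a, b)) = tpure a (q b) by exact: fext_gen.
have [l lP] : exists l : seq M, forall (K : lmodType R) (j : {linear K -> M}) q,
    (forall k, q (j k) = k) -> (forall m, m \in l -> exists k, j k = m) ->
    G K q (fgen S (n, y)) = 0.
  have : span (@tens_rel S R N M) (fgen S (n, y)).
    rewrite -[fgen S _]subr0; apply/qpi_eq; rewrite linear0; exact: n0.
  move: (fgen S (n, y)) => z; elim=> {z} [z zr||a z z' _ [l IHz] _ [l' IHz']].
  - case: zr => [a a' m|a m m'|a r m|s a m].
    + exists [::] => K j q _ _.
      by rewrite linearB [G K q (_ + fgen S (a', m))]linearD !GE tpureDl subrr.
    + exists [:: m; m'] => K j q qK jl.
      rewrite linearB [G K q (_ + fgen S (a, m'))]linearD !GE.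
      have [|k kE] := jl m; first by rewrite mem_head.
      have [|k' k'E] := jl m'; first by rewrite !inE eqxx orbT.
      by rewrite -kE -k'E -linearD !qK tpureDr subrr.
    + exists [:: m] => K j q qK jl; rewrite linearB !GE.
      have [|k <-] := jl m; first by rewrite mem_head.
      by rewrite -linearZ !qK tpureM subrr.
    + exists [::] => K j q _ _.
      by rewrite linearB [G K q (_ *: _)]linearZ !GE tpureZ subrr.
  - by exists [::] => K j q _ _; rewrite linear0.
  - exists (l ++ l') => K j q qK jl; rewrite linearP.
    rewrite (IHz K j) // ?(IHz' K j) // ?scaler0 ?addr0 // => m ml.
      by apply: jl; rewrite mem_cat ml orbT.
    by apply: jl; rewrite mem_cat ml.
exists l => K j y0 j_inj jy jl.
pose q m := if pselect (exists k, j k = m) is left e then sval (cid e) else 0.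
have qK k : q (j k) = k.
  rewrite /q; case: pselect => [e|[]]; last by exists k.
  by apply: j_inj; apply: (svalP (cid e)).
by have := lP K j q qK jl; rewrite GE -jy qK.
Qed.
End TensorLocal.

Section Skolem.
Variables R U : pzRingType.

(** Names for the elements of the smallest submodule that contains x and, for
    all s in U and each of its elements y, the entries of the finite list that
    witnesses s (x) y = 0. The point is that the type of names does not depend
    on the module. *)
Inductive skolem_term : Type :=
| svar
| sadd of skolem_term & skolem_term
| sscale of R & skolem_term
| switness of U & nat & skolem_term.

HB.instance Definition _ := gen_eqMixin skolem_term.
HB.instance Definition _ := gen_choiceMixin skolem_term.

Fixpoint skolem_eval (M : lmodType R) (x : M) (l : U -> M -> seq M)
    (t : skolem_term) : M :=
  match t with
  | svar => x
  | sadd t1 t2 => skolem_eval x l t1 + skolem_eval x l t2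
  | sscale a t1 => a *: skolem_eval x l t1
  | switness s k t1 => nth 0 (l s (skolem_eval x l t1)) k
  end.
End Skolem.

(** Discrete categories, whose colimits are coproducts. *)
Definition discrete_hom (X : choiceType) (i j : X) : Type := i = j.
HB.instance Definition _ (X : choiceType) (i j : X) :=
  gen_eqMixin (discrete_hom i j).
HB.instance Definition _ (X : choiceType) (i j : X) :=
  gen_choiceMixin (discrete_hom i j).

Section Discrete.
Variable X : choiceType.

Fact discrete_1c (i j : X) (f : i = j) : etrans f erefl = f.
Proof. by case: j / f. Qed.
Fact discrete_c1 (i j : X) (f : i = j) : etrans erefl f = f.
Proof. by case: j / f. Qed.
Fact discrete_A (i j k l : X) (h : k = l) (g : j = k) (f : i = j) :
  etrans (etrans f g) h = etrans f (etrans g h).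
Proof. by case: l / h; case: k / g; case: j / f. Qed.

Definition discrete_category : small_category :=
  @SmallCategory X (@discrete_hom X) (fun i => erefl i)
    (fun i j k g f => etrans f g) discrete_1c discrete_c1 discrete_A.

Variables (C : preadditive) (D : X -> C).

Definition discrete_map (i j : X) (f : i = j) : hom (D i) (D j) :=
  eq_rect i (fun k => hom (D i) (D k)) (idc (D i)) j f.
Fact discrete_mapc (i j k : X) (g : j = k) (f : i = j) :
  discrete_map (etrans f g) = discrete_map g \c discrete_map f.
Proof. by case: k / g; case: j / f; rewrite comp1c. Qed.

Definition discrete_diagram : diagram discrete_category C :=
  @Diagram discrete_category C D discrete_map (fun=> erefl) discrete_mapc.
End Discrete.

Section Generator.
Variables (R U : pzRingType) (u : {rmorphism R -> U}).
Variable F : flat_resolution (restr_right u).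
Local Notation C := (comodule_category u).
Local Notation W := (skolem_term R U).

(** As F1 is flat, phi is injective on every submodule of a comodule, so that
    only U (x) K = 0 has to be ensured. *)
Lemma comodule_sub (K M : lmodType R) (j : {linear K -> M}) : injective j ->
  comodule u M -> is_zero (tens (restr_bimodule u) K) -> comodule u K.
Proof.
move=> j_inj coM K0; apply/(comodule_phi F); split.
  move=> z z0; apply: (flat_res1 j_inj); rewrite [RHS]tmap0.
  by apply: (comodule_inj coM); rewrite phi_nat z0 tmap0.
by apply: (tens_eq0_phi F K).1; apply/tens_right_is_zero.
Qed.

(** The submodule named by the terms is a quotient of the free module on them.
    It is a comodule because it contains, with y, the witnesses of each equation
    s (x) y = 0. *)
Lemma small_subcomodule (M : lmodType R) (x : M) : comodule u M ->
  exists (B : set (free R W)) (j : {linear quomod B -> M}),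
    comodule u (quomod B) /\ exists y, j y = x.
Proof.
move=> coM; have [M0 _] := coM.
have Wl (s : U) (y : M) : exists l : seq M,
    forall (K : lmodType R) (j : {linear K -> M}) (y0 : K),
    injective j -> j y0 = y -> (forall m, m \in l -> exists k, j k = m) ->
    tpure (s : restr_bimodule u) y0 = 0 :> tens _ K.
  by apply: tpure_eq0_local; apply: M0.
pose l s y := sval (cid (Wl s y)).
pose ev := @skolem_eval R U M x l.
pose e : {linear free R W -> M} := fext ev.
have eE t : e (fgen R t) = ev t by exact: fext_gen.
pose B := [set z | e z = 0]%classic.
have eB z : B z -> e z = 0 by [].
pose j : {linear quomod B -> M} := qlift eB.
have jE z : j (qpi B z) = e z by exact: (qlift_pi eB).
have j_inj : injective j.
  apply: linear_inj => q; have [z <-] := qpi_surj q; rewrite jE => ez.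
  by rewrite -(linear0 (qpi B)); apply/qpi_eq/span_gen; rewrite subr0.
have e_img z : exists t, e z = ev t.
  elim/free_ind: z => [|a t z [t' IHz]].
    by exists (sscale 0 (svar R U)); rewrite linear0 /ev /= scale0r.
  by exists (sadd (sscale a t) t'); rewrite linearP eE IHz.
have ev_img t : exists q, j q = ev t by exists (qpi B (fgen R t)); rewrite jE.
exists B, j; split; last exact: (ev_img (svar R U)).
apply: (comodule_sub j_inj coM).
elim/tens_ind => [//|s q|y z -> ->]; last first.
  by rewrite addr0.
have [t qt] : exists t, j q = ev t.
  by have [z <-] := qpi_surj q; have [t tE] := e_img z; exists t; rewrite jE.
apply: (svalP (cid (Wl s (ev t))) _ j) => // m.
rewrite -/(l s (ev t)) => /(nthP 0)[k _ <-].
exact: (ev_img (switness s k t)).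
Qed.

Definition small_comodule := {B : set (free R W) | comodule u (quomod B)}.
HB.instance Definition _ := gen_eqMixin small_comodule.
HB.instance Definition _ := gen_choiceMixin small_comodule.

(** The generator is the coproduct of all comodules that are quotients of the
    free module on the terms. *)
Lemma comodule_generator : exists s : C, generator s.
Proof.
pose D (B : small_comodule) : C := cobj (svalP B).
have [c [t [_ t_univ]]] := comodule_cocomplete F (discrete_diagram D).
exists c => a b f g fg.
(* On each summand the map tells f and g apart whenever some map does; this
   avoids singling out one summand, which would need a transport. *)
pose s i : hom (D i) a :=
  if pselect (exists k : hom (D i) a, f \c k <> g \c k) is left e
  then sval (cid e) else 0.
have [|h [hE _]] := t_univ a s.
  by move=> i j f0; case: j / f0; apply: compc1.
exists h => fh.
have [x fgx] : exists x, cofun f x <> cofun g x.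
  by apply/existsNP => fg'; apply: fg; apply: cofun_inj.
have [B [j [coB [y jy]]]] := small_subcomodule x (carrierP a).
pose i : small_comodule := exist _ B coB.
have : f \c s i = g \c s i by rewrite -hE !compA fh.
rewrite /s; case: pselect => [e|[]]; first exact: (svalP (cid e)).
exists (j : hom (D i) a) => fj; apply: fgx; rewrite -jy.
exact: (cofun_eq fj (y : carrier (D i))).
Qed.

Lemma comodule_grothendieck : grothendieck C.
Proof.
split; first exact: (comodule_abelian F).
- exact: (comodule_cocomplete F).
- exact: (comodule_AB5 F).
- exact: comodule_generator.
Qed.
End Generator.

(** * Modules over an epimorphic extension *)
Section EndomorphismRing.
Variables (R : pzRingType) (V : lmodType R).

Definition endo : Type := {linear V -> V}.
HB.instance Definition _ := GRing.Zmodule.on endo.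

Definition endo_one : endo := lid V.
Definition endo_mul (f g : endo) : endo := lcomp f g.

Fact endo_mulA : associative endo_mul.
Proof. by move=> f g h; apply: linear_ext. Qed.
Fact endo_mul1l : left_id endo_one endo_mul.
Proof. by move=> f; apply: linear_ext. Qed.
Fact endo_mul1r : right_id endo_one endo_mul.
Proof. by move=> f; apply: linear_ext. Qed.
Fact endo_mulDl : left_distributive endo_mul +%R.
Proof. by move=> f g h; apply: linear_ext. Qed.
Fact endo_mulDr : right_distributive endo_mul +%R.
Proof. by move=> f g h; apply: linear_ext => x; apply: linearD. Qed.
HB.instance Definition _ := GRing.Zmodule_isPzRing.Build endo
  endo_mulA endo_mul1l endo_mul1r endo_mulDl endo_mulDr.
End EndomorphismRing.

Section Actions.
Variables (R U : pzRingType) (u : {rmorphism R -> U}).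
Local Notation Ub := (restr_bimodule u).
Local Notation Ur := (restr_right u).

(** An extension to U of the R-module structure of Y; a U-module, but without a
    second module structure on the type Y. *)
Record action (Y : lmodType R) := Action {
  act :> U -> Y -> Y;
  actDr : forall s y y', act s (y + y') = act s y + act s y';
  actDl : forall s s' y, act (s + s') y = act s y + act s' y;
  actM : forall s s' y, act (s * s') y = act s (act s' y);
  act_u : forall r y, act (u r) y = r *: y }.

Section ActionTheory.
Variables (Y : lmodType R) (a : action Y).

Lemma act1 y : a 1 y = y.
Proof. by rewrite -(rmorph1 u) act_u scale1r. Qed.

Fact act_is_zmod_morphism s : zmod_morphism (a s).
Proof.
move=> x y; apply: (@addIr _ (a s y)).
by rewrite -actDr !subrK.
Qed.
Lemma act0 s : a s 0 = 0.
Proof. exact: (raddf0 (pack_additive (act_is_zmod_morphism s))). Qed.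
Lemma actB s x y : a s (x - y) = a s x - a s y.
Proof. exact: act_is_zmod_morphism. Qed.

Fact act_is_linear s : @GRing.linear_for int (zmodule Y) (zmodule Y) *:%R (a s).
Proof.
move=> n x y; rewrite actDr; congr (_ + _).
exact: (raddfMz (pack_additive (act_is_zmod_morphism s)) n x).
Qed.
Definition act_endo s : endo (zmodule Y : lmodType int) :=
  pack_linear (act_is_linear s).

Fact act_endo_additive : zmod_morphism act_endo.
Proof.
move=> s s'; apply: (@addIr _ (act_endo s')); rewrite subrK.
apply: linear_ext => y; apply: etrans (esym (actDl a _ _ y)) _.
by rewrite subrK.
Qed.
Fact act_endo_multiplicative : monoid_morphism act_endo.
Proof.
split; first by apply: linear_ext => y; apply: act1.
by move=> s s'; apply: linear_ext => y; apply: actM.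
Qed.
Definition act_rmorphism : {rmorphism U -> endo (zmodule Y : lmodType int)} :=
  HB.pack_for {rmorphism U -> endo (zmodule Y : lmodType int)} act_endo
    (GRing.isZmodMorphism.Build _ _ _ act_endo_additive)
    (GRing.isMonoidMorphism.Build _ _ _ act_endo_multiplicative).

(** The multiplication map U (x) Y -> Y; it is a retraction of tens_unit. *)
Lemma act_tens :
  {m : {linear tens Ub Y -> Y} | forall s y, m (tpure s y) = a s y}.
Proof.
apply: (@tens_lift_linear _ _ Ub Y Y (fun s y => a s y))
  => [s s' y|s y y'|s r y|r s y].
- exact: actDl.
- exact: actDr.
- by rewrite [a _ y]actM act_u.
- by rewrite [a _ y]actM act_u.
Qed.
End ActionTheory.

Fact tens_act_subproof M s : {f : {additive tens Ub M -> tens Ub M} |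
  forall x m, f (tpure x m) = tpure (s * (x : U) : Ub) m}.
Proof.
apply: (@tens_lift _ _ Ub M (tens Ub M) (fun x m => tpure (s * (x : U) : Ub) m))
  => [x x' m|x m m'|x r m].
- by rewrite -tpureDl; congr tpure; apply: (mulrDr s).
- exact: tpureDr.
- by rewrite -tpureM; congr tpure; apply: mulrA.
Qed.
Definition tens_act M s := sval (tens_act_subproof M s).
Lemma tens_act_pure M s x m :
  tens_act M s (tpure x m) = tpure (s * (x : U) : Ub) m.
Proof. exact: svalP (tens_act_subproof M s) x m. Qed.

Fact tens_actDl M s s' z :
  tens_act M (s + s') z = tens_act M s z + tens_act M s' z.
Proof.
elim/tens_ind: z => [|x m|x y IHx IHy]; first by rewrite !raddf0 addr0.
  rewrite !tens_act_pure -tpureDl; congr tpure; exact: mulrDl.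
by rewrite !raddfD IHx IHy addrACA.
Qed.
Fact tens_actM M s s' z :
  tens_act M (s * s') z = tens_act M s (tens_act M s' z).
Proof.
elim/tens_ind: z => [|x m|x y IHx IHy]; first by rewrite !raddf0.
  by rewrite !tens_act_pure mulrA.
by rewrite !raddfD IHx IHy.
Qed.
Fact tens_act_u M r z : tens_act M (u r) z = r *: z.
Proof.
elim/tens_ind: z => [|x m|x y IHx IHy]; first by rewrite raddf0 scaler0.
  by rewrite tens_act_pure -tpureZ.
by rewrite raddfD IHx IHy scalerDr.
Qed.
Definition tens_action M : action (tens Ub M) :=
  @Action _ (tens_act M) (fun s => raddfD (tens_act M s)) (@tens_actDl M)
    (@tens_actM M) (@tens_act_u M).

Definition restr_action : action (restr u) :=
  @Action (restr u) (fun s x => s * (x : U)) (@mulrDr U) (@mulrDl U)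
    (fun s s' y => esym (mulrA s s' y)) (fun r y => erefl).

Fact tens_unit_is_linear (M : lmodType R) :
  linear (fun m : M => tpure ((1 : U) : Ub) m : tens Ub M).
Proof.
move=> r x z; rewrite tpureDr -tpureM -tpureZ; congr (tpure _ _ + _).
by rewrite /= /restr_ract /restr_scale mul1r [RHS]mulr1.
Qed.
Definition tens_unit (M : lmodType R) : {linear M -> tens Ub M} :=
  pack_linear (@tens_unit_is_linear M).

Section Epimorphism.
Hypothesis u_epi : ring_epi u.

(** Two extensions of the action are two ring maps from U to the additive
    endomorphisms of Y which agree on R. *)
Lemma action_unique (Y : lmodType R) (a b : action Y) s y : a s y = b s y.
Proof.
have ab : act_rmorphism a =1 act_rmorphism b.
  by apply: u_epi => r; apply: linear_ext => z; rewrite /= !act_u.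
pose ev (f : endo (zmodule Y : lmodType int)) := (f : {linear _ -> _}) y.
exact: (congr1 ev (ab s)).
Qed.

(** Conjugating the diagonal action on Y x Y' by the R-linear automorphism
    (y, y') |-> (y, y' + f y) gives a second extension of the same R-action. The
    two coincide, which says that f commutes with U. *)
Lemma action_linear (Y Y' : lmodType R) (a : action Y) (a' : action Y')
  (f : {linear Y -> Y'}) s y : f (a s y) = a' s (f y).
Proof.
pose p s (v : (Y * Y')%type) : (Y * Y')%type := (a s v.1, a' s v.2).
pose q s (v : (Y * Y')%type) : (Y * Y')%type :=
  (a s v.1, a' s (v.2 - f v.1) + f (a s v.1)).
have [P PE] : {P : action (Y * Y')%type | forall s v, P s v = p s v}.
  suff [h1 h2 h3 h4] : [/\ forall t v v', p t (v + v') = p t v + p t v',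
      forall t t' v, p (t + t') v = p t v + p t' v,
      forall t t' v, p (t * t') v = p t (p t' v) &
      forall r v, p (u r) v = r *: v] by exists (Action h1 h2 h3 h4).
  split; rewrite /p /=.
  - by move=> t v v'; rewrite !actDr.
  - by move=> t t' v; rewrite !actDl.
  - by move=> t t' v; rewrite !actM.
  - by move=> r v; rewrite !act_u.
have [Q QE] : {Q : action (Y * Y')%type | forall s v, Q s v = q s v}.
  suff [h1 h2 h3 h4] : [/\ forall t v v', q t (v + v') = q t v + q t v',
      forall t t' v, q (t + t') v = q t v + q t' v,
      forall t t' v, q (t * t') v = q t (q t' v) &
      forall r v, q (u r) v = r *: v] by exists (Action h1 h2 h3 h4).
  split; rewrite /q /=.
  - move=> t v v'; congr (_, _); first by rewrite !actDr.
    by rewrite linearD opprD addrACA !actDr linearD addrACA.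
  - move=> t t' v; congr (_, _); first by rewrite !actDl.
    by rewrite !actDl linearD addrACA.
  - by move=> t t' v; rewrite !actM addrK.
  - by move=> r [v v']; rewrite !act_u linearZ /= scalerBr subrK.
have := action_unique P Q s (y, 0); rewrite PE QE /p /q /= act0 => -[] /esym.
by rewrite sub0r -sub0r actB act0 sub0r addrC => /subr0_eq.
Qed.

(** The R-linear map y |-> 1 (x) y from Y to U (x) Y is U-linear. *)
Lemma tpure_action (Y : lmodType R) (a : action Y) s y :
  tpure (s : Ub) y = tpure ((1 : U) : Ub) (a s y).
Proof.
have := action_linear a (tens_action Y) (tens_unit Y) s y.
by rewrite /= [RHS]tens_act_pure => ->; rewrite mulr1.
Qed.

Lemma kermod_action (Y Y' : lmodType R) (f : {linear Y -> Y'}) :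
  action Y -> action Y' -> action (kermod f : lmodType R).
Proof.
move=> a a'.
have kP s (k : kermod f) : a s k \in kerp f.
  by apply/eqP; rewrite (action_linear a a') (eqP (kermodP k)) act0.
apply: (@Action _ (fun s k => Kermod (kP s k))) => *; apply: val_inj => /=.
- exact: actDr.
- exact: actDl.
- exact: actM.
- exact: act_u.
Qed.

Lemma quomod_action (Y : lmodType R) (B : set Y) (a : action Y) :
  (forall s b, B b -> B (a s b)) -> action (quomod B).
Proof.
move=> aB.
have spanB y : span B y -> forall s, span B (a s y).
  elim=> [x Bx s||r x z _ Bx _ Bz s]; first exact/span_gen/aB.
    by move=> s; rewrite act0; apply: span0.
  rewrite actDr -(act_u a) -actM -[a _ x]scale1r.
  exact: spanP (Bx _) (Bz _).
pose qa s (q : quomod B) := qpi B (a s (repr (q : Quotient.quot (spanp B)))).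
have qaE s y : qa s (qpi B y) = qpi B (a s y).
  apply/qpi_eq; rewrite -actB; apply: spanB.
  by apply/qpi_eq; rewrite qpi_repr.
apply: (@Action _ qa) => [s p q|s s' q|s s' q|r q].
- have [x <-] := qpi_surj p; have [y <-] := qpi_surj q.
  by rewrite -linearD !qaE actDr linearD.
- by have [x <-] := qpi_surj q; rewrite !qaE actDl linearD.
- by have [x <-] := qpi_surj q; rewrite !qaE actM.
- by have [x <-] := qpi_surj q; rewrite qaE act_u linearZ.
Qed.

Lemma homology_action (A B D : lmodType R) (f : {linear A -> B})
    (g : {linear B -> D}) :
  action A -> action B -> action D -> action (homology f g).
Proof.
move=> aA aB aD; have aK := kermod_action g aB aD.
apply: (quomod_action (a := aK)) => s k [a aE].
exists (aA s a).
rewrite (action_linear aA aB) aE.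
exact: esym (action_linear aK aB (kerval g) s k).
Qed.

Lemma tpure_action_right (Y : lmodType R) (a : action Y) s y :
  tpure (s : Ur) y = tpure ((1 : U) : Ur) (a s y).
Proof. by rewrite -!tens_right_pure (tpure_action a). Qed.

(** Tor1(U, Y) = 0 for each U-module Y. As a sequence of right U-modules,
    0 -> F1 (x) U -> F0 (x) U -> U -> 0 is exact and U is free, so it splits;
    and F_i (x) Y is the tensor product over U of F_i (x) U with Y. In terms of
    elements, e lifts 1 and x - e m(rho x) = phi (r x) defines a right U-linear
    retraction r of phi on F0 (x) U; the retraction on F0 (x) Y sends x (x) y to
    the image of r (x (x) 1) under evaluation at y. *)
Lemma phi_action_inj (F : flat_resolution Ur) :
  is_zero (Tor1 Ub (restr u)) -> forall (Y : lmodType R), action Y ->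
  forall z, @phi _ _ F Y z = 0 -> z = 0.
Proof.
move=> /tens_right_Tor1/(Tor1_eq0_phi F) V_inj Y a.
pose V : lmodType R := restr u.
have [x x' s|x s s'|x r s|m mE] :=
  @tens_lift _ _ Ur V U (fun x s => (x : U) * (s : U)).
- exact: mulrDl.
- exact: mulrDr.
- exact/esym/mulrA.
have m1 w : w = tpure ((1 : U) : Ur) (m w : V).
  elim/tens_ind: w => [|x s|w w' IHw IHw']; first by rewrite raddf0 tpure0r.
    by rewrite mE (tpure_action_right restr_action).
  by rewrite raddfD tpureDr -IHw -IHw'.
have RmL (s : U) : linear (fun x : V => (x : U) * s : V).
  by move=> r x y; rewrite /= mulrDl -mulrA.
pose Rm s := pack_linear (RmL s).
have [e eE] := rho_surj F (tpure ((1 : U) : Ur) ((1 : U) : V)).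
pose E s := tmap (biid (res0 F)) (Rm s) e.
have rhoE s : rho (E s) = tpure ((1 : U) : Ur) (s : V).
  by rewrite rho_nat eE tmap_pure /= mul1r.
have E_Rm s s' : tmap (biid (res0 F)) (Rm s) (E s') = E (s' * s).
  by apply: tmap_idcomp => x; apply/esym/mulrA.
have ED s s' : E (s + s') = E s + E s'.
  by apply: tmap_addr => x; apply: mulrDr.
have E0 : E 0 = 0 by apply: tmap_zero => x; apply: mulr0.
have /choice[r rE] x : exists w, @phi _ _ F V w = x - E (m (rho x)).
  by apply: rho_exact; rewrite rhoB rhoE -m1 subrr.
have r_uniq x w : phi w = x - E (m (rho x)) -> r x = w.
  by move=> wE; apply/subr0_eq/V_inj; rewrite phiB rE wE subrr.
have rD x y : r (x + y) = r x + r y.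
  apply: r_uniq; rewrite phiD !rE.
  by rewrite rhoD raddfD ED opprD addrACA.
have rRm s x : r (tmap (biid _) (Rm s) x) = tmap (biid _) (Rm s) (r x).
  apply: r_uniq; rewrite phi_nat rE tmapB E_Rm rho_nat; congr (_ - E _).
  elim/tens_ind: (rho x) => [|y t|y t IHy IHt].
  - by rewrite tmap0 raddf0 mul0r.
  - by rewrite tmap_pure !mE mulrA.
  - by rewrite tmapD !raddfD mulrDl IHy IHt.
have rphi w : r (phi w) = w.
  by apply: r_uniq; rewrite rho_phi raddf0 E0 subr0.
have evL y : linear (fun s : V => a s y).
  by move=> t s s'; rewrite actDl [a _ y]actM act_u.
pose ev y := pack_linear (evL y).
have [x x' y|x y y'|x t y|k kE] := @tens_lift _ _ (res0 F) Y (tens (res1 F) Y)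
  (fun x y => tmap (biid _) (ev y) (r (tpure x ((1 : U) : V)))).
- by rewrite tpureDl rD tmapD.
- by apply: tmap_addr => s; apply: actDr.
- have -> : tpure (ract x t) ((1 : U) : V) =
      tmap (biid (res0 F)) (Rm (u t)) (tpure x ((1 : U) : V)).
    rewrite tpureM tmap_pure; congr tpure.
    by rewrite /= mul1r [LHS]mulr1.
  by rewrite rRm; apply: tmap_idcomp => s; rewrite /= actM act_u.
have kphi z : k (phi z) = z.
  elim/tens_ind: z => [|n y|z z' IHz IHz']; first by rewrite phi0 raddf0.
    rewrite {1}/phi tmap_pure kE.
    have -> : tpure (resd F n) ((1 : U) : V) = phi (tpure n ((1 : U) : V)).
      by rewrite /phi tmap_pure.
    by rewrite rphi tmap_pure /= act1.
  by rewrite phiD raddfD IHz IHz'.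
by move=> z z0; rewrite -[z]kphi z0 raddf0.
Qed.
End Epimorphism.
End Actions.

(** * Gamma takes values in comodules *)
Section RegularTensor.
Variables (R : pzRingType).
Local Notation Rb := (regular_bimodule R).

Lemma tens_regular (M : lmodType R) :
  {n : {linear tens Rb M -> M} |
    forall r m, n (tpure (r : Rb) m) = (r : R) *: m}.
Proof.
apply: (@tens_lift_linear _ _ Rb M M (fun r m => (r : R) *: m)) => *.
- exact: scalerDl.
- exact: scalerDr.
- exact/esym/scalerA.
- exact/esym/scalerA.
Qed.

Definition reg (M : lmodType R) : {linear tens Rb M -> M} :=
  sval (tens_regular M).
Lemma reg_pure (M : lmodType R) (r : R) m : reg M (tpure (r : Rb) m) = r *: m.
Proof. exact: svalP (tens_regular M) r m. Qed.

Fact reg_unit_is_linear (M : lmodType R) :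
  linear (fun m : M => tpure ((1 : R) : Rb) m : tens Rb M).
Proof.
move=> r x z; rewrite tpureDr -tpureM -tpureZ; congr (tpure _ _ + _).
by rewrite /= mul1r [RHS]mulr1.
Qed.
Definition reg_unit (M : lmodType R) : {linear M -> tens Rb M} :=
  pack_linear (@reg_unit_is_linear M).

Lemma regK (M : lmodType R) : cancel (reg M) (reg_unit M).
Proof.
elim/tens_ind => [|r m|x y IHx IHy]; first by rewrite !linear0.
  by rewrite reg_pure /= -tpureM /= mul1r.
by rewrite !linearD IHx IHy.
Qed.

Lemma tpure_regular (M : lmodType R) (r : R) (m : M) :
  tpure (r : Rb) m = r *: tpure ((1 : R) : Rb) m :> tens Rb M.
Proof. by rewrite -[RHS]/(r *: reg_unit M m) -linearZ /= -tpureM /= mul1r. Qed.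

Lemma reg_nat (M M' : lmodType R) (f : {linear M -> M'}) z :
  reg M' (tmap (biid Rb) f z) = f (reg M z).
Proof.
elim/tens_ind: z => [|r m|x y IHx IHy]; first by rewrite tmap0 !linear0.
  by rewrite tmap_pure !reg_pure linearZ.
by rewrite tmapD (linearD (reg M')) IHx IHy -!linearD.
Qed.
End RegularTensor.

Section Gamma.
Variables (R U : pzRingType) (u : {rmorphism R -> U}).
Hypothesis u_epi : ring_epi u.
Hypothesis Tor1_UU : is_zero (Tor1 (restr_bimodule u) (restr u)).
Variable F : flat_resolution (restr_right u).
Local Notation Rb := (regular_bimodule R).
Local Notation Ub := (restr_bimodule u).
Local Notation Ur := (restr_right u).
Local Notation action := (action u).
Local Notation "1U" := ((1 : U) : Ub).

(** The sequence of complexes 0 -> F1 (x) X -> F0 (x) X -> U (x) X -> 0 is exact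
    where phi is injective; as U (x) X is exact at X2 and X1, phi induces an
    isomorphism between the homologies of the first two complexes at X1. These
    are F1 (x) H and F0 (x) H with H the homology of X, because F1 and F0 are
    flat. *)
Lemma homology_comodule (X3 X2 X1 X0 : lmodType R) (d3 : {linear X3 -> X2})
    (d2 : {linear X2 -> X1}) (d1 : {linear X1 -> X0}) :
  (forall x, d2 (d3 x) = 0) -> (forall x, d1 (d2 x) = 0) ->
  (forall z, @phi _ _ F X1 z = 0 -> z = 0) ->
  (forall z, @phi _ _ F X0 z = 0 -> z = 0) ->
  (forall z, tmap (biid Ub) d2 z = 0 -> exists y, tmap (biid Ub) d3 y = z) ->
  (forall z, tmap (biid Ub) d1 z = 0 -> exists y, tmap (biid Ub) d2 y = z) ->
  comodule u (homology d2 d1).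
Proof.
move=> dd3 dd2 X1_inj X0_inj /tens_right_exact ex2 /tens_right_exact ex1.
have tdd3 (K : right_module R) z : tmap (biid K) d2 (tmap (biid K) d3 z) = 0.
  by rewrite (tmap_idcomp _ (g := lzero _ _)) ?tmap_zero.
have tdd2 (K : right_module R) z : tmap (biid K) d1 (tmap (biid K) d2 z) = 0.
  by rewrite (tmap_idcomp _ (g := lzero _ _)) ?tmap_zero.
pose i := kerval d1.
have [f fE] : exists f : {linear X2 -> kermod d1}, forall x, i (f x) = d2 x.
  by apply: linear_lift; [apply: kerval_inj | move=> x; apply/kerval_exact].
pose p := hpi d2 d1; have p_surj := @hpi_surj _ _ _ _ d2 d1.
have p_exact k : p k = 0 -> exists x, f x = k.
  move=> /hpi_eq0[x xE]; exists x; apply: kerval_inj; exact: etrans (fE x) xE.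
have pf x : p (f x) = 0 by apply/hpi_eq0; exists x; apply/esym/fE.
have tpf (K : right_module R) z : tmap (biid K) p (tmap (biid K) f z) = 0.
  by rewrite (tmap_idcomp _ (g := lzero _ _)) ?tmap_zero.
have tif (K : right_module R) z :
    tmap (biid K) i (tmap (biid K) f z) = tmap (biid K) d2 z.
  exact: tmap_idcomp.
have tp_surj (K : right_module R) z : exists w, tmap (biid K) p w = z.
  by apply: tmap_surj => // n; exists n.
apply/(comodule_phi F); split=> z.
  have [z1 <-] := tp_surj _ z; rewrite phi_nat => z1_0.
  have [w wE] := tens_rexact p_surj p_exact z1_0.
  have dw : tmap (biid _) d2 w = phi (tmap (biid _) i z1).
    by rewrite phi_nat -wE tif.
  have [|v0 v0E] := ex2 (rho w); first by rewrite -rho_nat dw rho_phi.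
  have [v vE] := rho_surj F v0.
  have [|w' w'E] := @rho_exact _ _ F _ (w - tmap (biid _) d3 v).
    by rewrite rhoB rho_nat vE v0E subrr.
  have iz1 : tmap (biid _) i z1 = tmap (biid _) i (tmap (biid _) f w').
    apply/subr0_eq/X1_inj.
    by rewrite phiB -dw tif phi_nat w'E tmapB tdd3 subr0 subrr.
  by rewrite (flat_res1 (@kerval_inj _ _ _ d1) iz1) tpf.
have [y1 <-] := tp_surj _ z; pose iy := tmap (biid _) i y1.
have diy : tmap (biid _) d1 iy = 0.
  rewrite (tmap_idcomp _ (g := lzero _ _)) ?tmap_zero // => k.
  by apply/kerval_exact; exists k.
have [|x0 x0E] := ex1 (rho iy); first by rewrite -rho_nat diy /rho tmap0.
have [x xE] := rho_surj F x0.
have [|y' y'E] := @rho_exact _ _ F _ (iy - tmap (biid _) d2 x).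
  by rewrite rhoB rho_nat xE x0E subrr.
have [||y2 y2E] := @flat_exact _ _ (@flat_res1 _ _ F) _ _ _ i d1 _ y'.
- by move=> k; apply: (kerval_exact d1 k).1.
- by apply: X0_inj; rewrite phi_nat y'E tmapB diy tdd2 subr0.
exists (tmap (biid _) p y2); rewrite phi_nat.
have -> : phi y2 = y1 - tmap (biid _) f x.
  apply: (flat_res0 (@kerval_inj _ _ _ d1)).
  by rewrite -phi_nat y2E y'E tmapB tif.
by rewrite tmapB tpf subr0.
Qed.

Lemma phi_regular_inj (X : choiceType) z :
  @phi _ _ F (tens Rb (free R X)) z = 0 -> z = 0.
Proof.
move=> z0.
have <- : tmap (biid _) (reg_unit _) (tmap (biid _) (reg (free R X)) z) = z.
  by rewrite (tmap_idcomp _ (g := lid _)) ?tmap_id //; apply: regK.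
have -> : tmap (biid _) (reg (free R X)) z = 0; last exact: tmap0.
apply: (tens_free_inj (@resd_inj _ _ F)).
by rewrite -/(phi _) -[RHS]/(phi _) phi_nat z0 phi0 tmap0.
Qed.

Lemma tens_prod_ind (A B : lmodType R)
    (P : tens Ub (tens Rb A * tens Ub B)%type -> Prop) :
  (forall x y, P x -> P y -> P (x + y)) ->
  (forall s r a, P (tpure (s : Ub) (tpure (r : Rb) a, 0))) ->
  (forall s s' b, P (tpure (s : Ub) (0, tpure (s' : Ub) b))) ->
  forall z, P z.
Proof.
move=> PD PA PB.
have P0 : P 0 by have := PA 0 0 0; rewrite tpure0l.
elim/tens_ind => // s [q v].
have -> : (q, v) = (q, 0) + (0, v) :> (tens Rb A * tens Ub B)%type.
  by congr (_, _); rewrite /= ?addr0 ?add0r.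
rewrite tpureDr; apply: (PD).
  move: q; apply: tens_ind => [|r a|x y IHx IHy].
  - by rewrite tpure0r.
  - exact: PA.
  have -> : (x + y, 0) = (x, 0) + (y, 0) :> (tens Rb A * tens Ub B)%type.
    by congr (_, _); rewrite /= addr0.
  by rewrite tpureDr; apply: (PD).
move: v; apply: tens_ind => [|s' b|x y IHx IHy].
- by rewrite tpure0r.
- exact: PB.
have -> : (0, x + y) = (0, x) + (0, y) :> (tens Rb A * tens Ub B)%type.
  by congr (_, _); rewrite /= addr0.
by rewrite tpureDr; apply: (PD).
Qed.

(** U (x) - turns the cone of R (x) P -> U (x) P into the cone of an
    isomorphism, hence has a contracting homotopy: it projects to
    U (x) U (x) P, multiplies, and includes U (x) P in the next degree. Here d
    is the differential out of one degree Y of the cone, and e the part of the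
    differential into Y which the homotopy uses; sX and sY are the homotopy on X
    and Y before the inclusion. *)
Lemma cone_exact (A B X : lmodType R) (h : {linear B -> A})
    (d : {linear (tens Rb A * tens Ub B)%type -> X})
    (e : {linear B -> (tens Rb A * tens Ub B)%type})
    (sX : {linear tens Ub X -> tens Ub A}) :
  (forall b, e b = (- tpure ((1 : R) : Rb) (h b), tpure 1U b)) ->
  (forall s r a, sX (tpure (s : Ub) (d (tpure (r : Rb) a, 0))) =
                 tpure (s * u r : Ub) a) ->
  (forall s s' b, sX (tpure (s : Ub) (d (0, tpure (s' : Ub) b))) =
                  tpure ((s : U) * (s' : U) : Ub) (h b)) ->
  forall z, tmap (biid Ub) d z = 0 -> exists y, tmap (biid Ub) e y = z.
Proof.
move=> eE sXa sXb.
pose Y := (tens Rb A * tens Ub B)%type : lmodType R.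
have iL : linear (fun a : A => (tpure ((1 : R) : Rb) a, 0) : Y).
  move=> r x y; congr (_, _); last by rewrite /= scaler0 addr0.
  exact: (reg_unit_is_linear r x y).
have jL : linear (fun v : tens Ub B => (0, v) : Y).
  by move=> r x y; congr (_, _); rewrite /= scaler0 addr0.
have qL : linear (fun y : Y => y.2 : tens Ub B) by [].
pose i := pack_linear iL; pose j := pack_linear jL; pose q := pack_linear qL.
have [m mE] := act_tens (tens_action u B).
pose sY z := m (tmap (biid Ub) q z).
have homotopy z : z = tmap (biid Ub) e (sY z) +
                      tmap (biid Ub) i (sX (tmap (biid Ub) d z)).
  elim/tens_prod_ind: z => [x y IHx IHy|s r a|s s' b].
  - have sYD : sY (x + y) = sY x + sY y by rewrite /sY tmapD linearD.
    rewrite sYD (tmapD _ d) [sX (_ + _)]linearD !tmapD addrACA.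
    congr (_ + _); [exact: IHx | exact: IHy].
  - rewrite /sY !tmap_pure sXa tpure0r linear0 tmap0 add0r.
    have -> : (tpure (r : Rb) a, 0) = (r : R) *: i a :> Y.
      congr (_, _); first exact: tpure_regular.
      by rewrite /= scaler0.
    by rewrite -tpureM tmap_pure.
  - rewrite /sY !tmap_pure sXb /= mE /= tens_act_pure !tmap_pure /= eE.
    rewrite -tpureDr.
    have -> : (- tpure ((1 : R) : Rb) (h b), tpure 1U b) +
        (tpure ((1 : R) : Rb) (h b), 0) = j (tpure 1U b).
      by congr (_, _); rewrite /= ?addNr ?addr0.
    have := congr1 (tmap (biid Ub) j) (_ : tpure s (tpure s' b) =
      tpure ((s : U) * (s' : U) : Ub) (tpure 1U b)).
    rewrite !tmap_pure; apply.
    rewrite (tpure_action u_epi (tens_action u B)).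
    rewrite [RHS](tpure_action u_epi (tens_action u B)) /= !tens_act_pure.
    by rewrite mulr1.
move=> z z0; exists (sY z); apply/esym/(etrans (homotopy z)).
by rewrite z0 [sX 0]linear0 tmap0 addr0.
Qed.
End Gamma.

Section GammaComodule.
Variables (R U : pzRingType) (u : {rmorphism R -> U}).
Hypothesis u_epi : ring_epi u.
Hypothesis Tor1_UU : is_zero (Tor1 (restr_bimodule u) (restr u)).
Variable F : flat_resolution (restr_right u).
Local Notation Rb := (regular_bimodule R).
Local Notation Ub := (restr_bimodule u).
Local Notation action := (action u).
Local Notation "1U" := ((1 : U) : Ub).
Local Notation k := (restr_unit u).
Variable A : lmodType R.

Lemma d1_d2 p : d1 A (d2 A p) = 0. Proof. exact: cover_ker. Qed.
Lemma augm_d1 p : augm A (d1 A p) = 0. Proof. exact: cover_ker. Qed.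

Lemma restr_unit_pure (M : lmodType R) (r : R) m :
  tmap k (lid M) (tpure (r : Rb) m) = tpure (u r : Ub) m.
Proof. exact: tmap_pure. Qed.

Lemma dtot1E q v :
  dtot1 k A (q, v) = tmap k (lid _) q + tmap (biid Ub) (d1 A) v.
Proof. by []. Qed.

Lemma dtot2E q v :
  dtot2 k A (q, v) = (- tmap (biid Rb) (d1 A) q,
                      tmap k (lid _) q + tmap (biid Ub) (d2 A) v).
Proof. by []. Qed.

Lemma dtot1_dtot2 x : dtot1 k A (dtot2 k A x) = 0.
Proof.
case: x => q v; rewrite dtot2E dtot1E tmapN tmapD tmap_swap addKr.
by rewrite (tmap_idcomp _ (g := lzero _ _)) ?tmap_zero //; apply: d1_d2.
Qed.

Fact cone_in_is_linear (B C : lmodType R) (h : {linear B -> C}) :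
  linear (fun b : B => (- tpure ((1 : R) : Rb) (h b), tpure 1U b) :
                       (tens Rb C * tens Ub B)%type).
Proof.
move=> r x y; congr (_, _); last exact: (tens_unit_is_linear u r x y).
rewrite linearP [X in - X](reg_unit_is_linear r (h x) (h y)).
by rewrite opprD /= scalerN.
Qed.
(** The differential of the cone on the summand R (x) B, identified with B. *)
Definition cone_in (B C : lmodType R) (h : {linear B -> C}) :
  {linear B -> (tens Rb C * tens Ub B)%type} :=
  pack_linear (cone_in_is_linear h).

(** The complex that defines Gamma stops in degree 2; P2 in degree 3, through
    which the contracting homotopy passes, makes its tensor product with U exact
    in degree 2 as well. *)
Lemma Gamma_comodule : comodule u (Gamma u A).
Proof.
have phi_tens (M : lmodType R) z : @phi _ _ F (tens Ub M) z = 0 -> z = 0.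
  exact: (phi_action_inj u_epi Tor1_UU (tens_action u M)).
have act_pure (M : lmodType R) :
    {m : {linear tens Ub (tens Ub M) -> tens Ub M} |
    forall s s' x, m (tpure (s : Ub) (tpure (s' : Ub) x)) =
                   tpure ((s : U) * (s' : U) : Ub) x}.
  have [m mE] := act_tens (tens_action u M).
  by exists m => s s' x; rewrite mE /= tens_act_pure.
have [m0 m0E] := act_pure (P0 A); have [m1 m1E] := act_pure (P1 A).
have qL : linear (fun y : tot1 Rb Ub A => y.2 : tens Ub (P1 A)) by [].
apply: (@homology_comodule _ _ u F _ _ _ _ (cone_in (d2 A))).
- move=> p; rewrite /cone_in /= dtot2E !tmapN !tmap_pure /= d1_d2 tpure0r.
  rewrite /restr_unit_fun rmorph1 addNr !oppr0 //.
- exact: dtot1_dtot2.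
- apply: phi_prod_inj; last exact: phi_tens.
  by have := @phi_regular_inj _ _ u F A; apply.
- exact: phi_tens.
- apply: (@cone_exact _ _ u u_epi _ _ (tot1 Rb Ub A) (d2 A) (dtot2 k A)
    (cone_in (d2 A)) (lcomp m1 (tmap (biid Ub) (pack_linear qL))))
    => [//|s r a|s s' b].
    by rewrite dtot2E /= tmap_pure /= tmap0 addr0 restr_unit_pure m1E.
  by rewrite dtot2E /= tmap_pure /= tmap0 add0r tmap_pure m1E.
- have iL : linear (fun p : P1 A => (tpure ((1 : R) : Rb) p, 0) : tot2 Rb Ub A).
    move=> r x y; congr (_, _); last by rewrite /= scaler0 addr0.
    exact: (reg_unit_is_linear r x y).
  pose i : {linear P1 A -> tot2 Rb Ub A} := pack_linear iL.
  move=> z dz.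
  have [//|||y <-] := @cone_exact _ _ u u_epi _ _ (tot0 Ub A) (d1 A) (dtot1 k A)
    (cone_in (d1 A)) m0 _ _ _ z dz.
  + by move=> s r a; rewrite dtot1E tmap0 addr0 restr_unit_pure m0E.
  + by move=> s s' b; rewrite dtot1E tmap0 add0r tmap_pure m0E.
  exists (tmap (biid Ub) i y); apply: tmap_idcomp => p.
  rewrite /i /= dtot2E tmap0 addr0 !tmap_pure /=.
  by rewrite /restr_unit_fun rmorph1.
Qed.
End GammaComodule.

(** * Gamma is right adjoint to the inclusion of comodules *)
Section Coreflection.
Variables (R U : pzRingType) (u : {rmorphism R -> U}).
Hypothesis u_epi : ring_epi u.
Variable F : flat_resolution (restr_right u).
Local Notation Rb := (regular_bimodule R).
Local Notation Ub := (restr_bimodule u).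
Local Notation Ur := (restr_right u).
Local Notation action := (action u).
Implicit Types A E G M Y : lmodType R.

(** A map from M to a U-module factors through U (x) M. *)
Lemma hom_to_action M Y (a : action Y) (f : {linear M -> Y}) m :
  is_zero (tens Ub M) -> f m = 0.
Proof.
move=> M0; have [n nE] := act_tens a.
rewrite -(act1 a (f m)) -nE -[tpure _ _](tmap_pure (biid Ub) f).
by rewrite [tpure _ m]M0 tmap0 linear0.
Qed.

(** The kernel of U (x) Y -> U (x) E is a quotient of Tor1(U, M) = 0. *)
Lemma tens_mono_of_comodule Y E M (i : {linear Y -> E}) (p : {linear E -> M}) :
  injective i -> (forall x, p x = 0 <-> exists y, i y = x) ->
  (forall m, exists x, p x = m) -> comodule u M ->
  injective (tmap (biid Ub) i).
Proof.
move=> i_inj p_exact p_surj coM; apply: linear_inj => z z0.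
apply/tens_right_eq0; have [x xE] := rho_surj F (tens_right u Y z).
have [|w wE] := @rho_exact _ _ F _ (tmap (biid _) i x).
  by rewrite rho_nat xE -tens_right_nat z0 raddf0.
have [//|||w' w'E] := @tens_rexact _ _ (res1 F) _ _ _ i p _ _ w.
- by move=> e /p_exact.
- apply: (comodule_inj coM); rewrite phi_nat wE.
  rewrite (tmap_idcomp _ (g := lzero _ _)) ?tmap_zero // => y.
  by apply/p_exact; exists y.
rewrite -xE; have -> : x = phi w'; last exact: rho_phi.
by apply: (flat_res0 i_inj); rewrite -phi_nat w'E.
Qed.

(** Ext1(M, Y) = 0. The inclusion i becomes an isomorphism after U (x) -, so
    E -> U (x) E = U (x) Y -> Y is a retraction of it. *)
Lemma action_ext_retract Y E M (a : action Y) (i : {linear Y -> E})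
    (p : {linear E -> M}) :
  injective i -> (forall x, p x = 0 <-> exists y, i y = x) ->
  (forall m, exists x, p x = m) -> comodule u M ->
  exists r : {linear E -> Y}, forall y, r (i y) = y.
Proof.
move=> i_inj p_exact p_surj coM.
have ti_inj := tens_mono_of_comodule i_inj p_exact p_surj coM.
have [|h hE] := @linear_lift _ _ _ _
  (tmap (biid Ub) i : {linear tens Ub Y -> tens Ub E}) (tens_unit u E) ti_inj.
  move=> e; apply: (@tens_rexact _ _ Ub _ _ _ i p) => //.
    by move=> x /p_exact.
  by have [M0 _] := coM; apply: M0.
have [m mE] := act_tens a.
exists (lcomp m h) => y /=.
have -> : h (i y) = tens_unit u Y y.
  by apply: ti_inj; rewrite [LHS]hE /= tmap_pure.
by rewrite mE act1.
Qed.

(** The pullback E of e along h is an extension of M by Y. A retraction r of it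
    gives the lift, which sends m to g - j (r (g, m)) for any (g, m) in E. *)
Lemma comodule_lift Y G A M (a : action Y) (j : {linear Y -> G})
    (e : {linear G -> A}) (h : {linear M -> A}) :
  injective j -> (forall g, e g = 0 <-> exists y, j y = g) ->
  comodule u M -> (forall m, exists g, e g = h m) ->
  exists h' : {linear M -> G}, forall m, e (h' m) = h m.
Proof.
move=> j_inj e_exact coM h_img.
have dL : linear (fun x : G * M => e x.1 - h x.2).
  by move=> r x y; rewrite /= !linearP scalerDr addrACA.
pose d := pack_linear dL; pose E := kermod d : lmodType R.
have [v [v_inj v_exact]] : exists v : {linear E -> (G * M)%type},
    injective v /\ forall y, d y = 0 <-> exists x, v x = y.
  by exists (kerval d); split; [apply: kerval_inj | apply: kerval_exact].
have EP x : e (v x).1 = h (v x).2 by apply/subr0_eq/v_exact; exists x.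
have lift_pair g m : e g = h m -> exists x, v x = (g, m).
  by move=> gm; apply/v_exact; rewrite /= gm subrr.
have iL : linear (fun y => (j y, 0) : G * M).
  by move=> r x y; congr (_, _); rewrite ?linearP //= scaler0 addr0.
have [i iE] : exists i : {linear Y -> E}, forall y, v (i y) = (j y, 0).
  have [//|y|i iE] := @linear_lift _ E _ Y v (pack_linear iL); last by exists i.
  by apply: lift_pair; rewrite linear0; apply/e_exact; exists y.
have pL : linear (fun x : E => (v x).2) by move=> r x y; rewrite linearP.
pose p : {linear E -> M} := pack_linear pL.
have p_surj m : exists x, p x = m.
  by have [g /lift_pair[x xE]] := h_img m; exists x; rewrite /= xE.
have p_exact x : p x = 0 <-> exists y, i y = x.
  split=> [x2|[y <-]]; last by rewrite /= iE.
  have [|y yE] := (e_exact (v x).1).1; first by rewrite EP [_.2]x2 linear0.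
  by exists y; apply: v_inj; rewrite iE yE -[X in (_, X)]x2 /=; case: (v x).
have i_inj : injective i.
  by move=> y y' yy; apply: j_inj; have := congr1 v yy; rewrite !iE => -[].
have [r rE] := action_ext_retract a i_inj p_exact p_surj coM.
have qL : linear (fun x : E => (v x).1 - j (r x)).
  by move=> s x y; rewrite /= !linearP scalerDr addrACA.
have [//|x|h' h'E] := @linear_desc _ E M G p (pack_linear qL).
  by move=> /p_exact[y <-]; rewrite /= iE rE subrr.
exists h' => m; have [x <-] := p_surj m.
rewrite h'E /= linearB EP.
have -> : e (j (r x)) = 0 by apply/e_exact; eexists.
exact: subr0.
Qed.

Local Notation "1U" := ((1 : U) : Ub).

(** The long exact sequence 0 -> Tor1(U, A) -> Gamma(A) -> A -> U (x) A of the
    triangle R -> U -> K. On cycles e sends (r (x) p, v) to r times the image of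
    p in A, and j sends v to (0, v). *)
Lemma Gamma_counit A :
  exists (j : {linear Tor1 Ub A -> Gamma u A}) (e : {linear Gamma u A -> A}),
  [/\ injective j, forall g, e g = 0 <-> exists y, j y = g &
      forall a, tens_unit u A a = 0 -> exists g, e g = a].
Proof.
pose k := restr_unit u.
pose T1 := tmap (biid Ub) (d1 A) : {linear _ -> _}.
pose T2 := tmap (biid Ub) (d2 A) : {linear _ -> _}.
pose D1 := dtot1 k A; pose D2 := dtot2 k A.
have pairL : linear (fun y : tens Ub (P1 A) => (0, y) : tot1 Rb Ub A).
  by move=> r x y; congr (_, _); rewrite /= scaler0 addr0.
have fstL : linear (fun x : tot1 Rb Ub A => x.1 : tens Rb (P0 A)) by [].
have [j0 j0E] : exists j0 : {linear kermod T1 -> kermod D1},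
    forall y, kerval D1 (j0 y) = (0, kerval T1 y).
  have [y|j0 j0E] := @linear_lift _ _ _ _ (kerval D1)
      (lcomp (pack_linear pairL) (kerval T1)) (@kerval_inj _ _ _ D1).
    apply/kerval_exact; rewrite /D1 dtot1E tmap0 add0r.
    by apply/(kerval_exact T1); exists y.
  by exists j0 => y; rewrite j0E.
pose L := lcomp (augm A) (lcomp (reg (P0 A)) (pack_linear fstL)).
have LE x : L x = augm A (reg _ x.1) by [].
have L_D2 x : L (D2 x) = 0.
  case: x => q v; rewrite LE [D2 _]dtot2E linearN reg_nat linearN.
  by rewrite augm_d1 oppr0.
have [j jE] : exists j : {linear Tor1 Ub A -> Gamma u A},
    forall y, j (hpi T2 T1 y) = hpi D2 D1 (j0 y).
  apply: (linear_desc (p := hpi T2 T1) (g := lcomp (hpi D2 D1) j0)).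
    exact: hpi_surj.
  move=> y /hpi_eq0[x xE]; apply/hpi_eq0; exists (0, x).
  apply: etrans (esym (j0E y)); rewrite [D2 _]dtot2E !tmap0 oppr0 add0r.
  by congr (_, _).
have [e eE] : exists e : {linear Gamma u A -> A},
    forall x, e (hpi D2 D1 x) = L (kerval D1 x).
  apply: (linear_desc (p := hpi D2 D1) (g := lcomp L (kerval D1))).
    exact: hpi_surj.
  by move=> x /hpi_eq0[y yE]; apply: etrans (L_D2 y); congr (L _).
exists j, e; split.
- apply: linear_inj => y; have [z <-] := hpi_surj y.
  rewrite jE => /hpi_eq0[[q v] qvE].
  have := etrans qvE (j0E z).
  rewrite [D2 _]dtot2E => -[/eqP]; rewrite oppr_eq0 => /eqP dq qv.
  have [|p pE] := @cover_exact _ _ _ (d1 A) (reg _ q).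
    by rewrite -reg_nat dq linear0.
  apply/hpi_eq0; exists (tpure 1U p + v).
  apply: etrans qv; rewrite [LHS]tmapD; congr (_ + _).
  rewrite tmap_pure [d2 A p]pE -{2}[q]regK /= restr_unit_pure.
  by rewrite rmorph1.
- move=> g; have [x <-] := hpi_surj g; rewrite eE.
  case xE: (kerval D1 x) => [q v]; split=> [|[y]]; last first.
    have [z <-] := hpi_surj y; rewrite jE => /hpi_eq[w wE].
    have {}wE : D2 w = (0, kerval T1 z) - (q, v) by rewrite -j0E -xE.
    apply/eqP; rewrite -oppr_eq0 -linearN.
    rewrite [- _](_ : _ = D2 w - (0, kerval T1 z)); last first.
      by rewrite wE addrAC subrr add0r.
    by rewrite linearB L_D2 LE !linear0 addr0.
  (* q is the boundary of 1 (x) p, so adding the boundary w moves (q, v) into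
     the summand U (x) P1. *)
  rewrite LE => /cover_exact[p pE].
  pose w := D2 (tpure ((1 : R) : Rb) p, 0).
  have wE : w = (- q, tpure 1U p).
    rewrite /w [D2 _]dtot2E tmap0 addr0 restr_unit_pure rmorph1 tmap_pure.
    by rewrite [d1 A p]pE [tpure _ _]regK.
  have qvw : (0, v + tpure 1U p) = (q, v) + w :> tot1 Rb Ub A.
    by rewrite wE; congr (_, _); rewrite /= subrr.
  have dqvw : D1 (0, v + tpure 1U p) = 0.
    rewrite qvw linearD [D1 w]dtot1_dtot2 addr0.
    by apply/(kerval_exact D1); exists x.
  have [|y yE] := (kerval_exact T1 (v + tpure 1U p)).1.
    by rewrite -dqvw [RHS]dtot1E tmap0 add0r.
  exists (hpi T2 T1 y); rewrite jE; apply/hpi_eq.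
  exists (tpure ((1 : R) : Rb) p, 0).
  suff: w = kerval D1 (j0 y) - kerval D1 x by [].
  by rewrite j0E yE xE qvw addrC addKr.
- move=> a a0.
  have [||y yE] := @tens_rexact _ _ Ub _ _ _ (d1 A) (augm A) (@augm_surj _ A) _
      (tpure ((1 : U) : Ub) (fgen R a)).
  - by move=> p /cover_exact.
  - by rewrite tmap_pure augm_gen.
  have [x xE] : exists x, kerval D1 x = (tpure ((1 : R) : Rb) (fgen R a), - y).
    apply/kerval_exact; rewrite /D1 dtot1E restr_unit_pure rmorph1 tmapN yE.
    by rewrite subrr.
  exists (hpi D2 D1 x); rewrite eE xE LE /=.
  by rewrite reg_pure scale1r augm_gen.
Qed.

Lemma Tor1_action A : action (Tor1 Ub A).
Proof. by apply: (homology_action u_epi); apply: tens_action. Qed.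

Lemma Gamma_coreflection A :
  exists e : {linear Gamma u A -> A}, forall M, comodule u M ->
  (forall h : {linear M -> A}, exists h' : {linear M -> Gamma u A},
     forall m, e (h' m) = h m) /\
  (forall f g : {linear M -> Gamma u A},
     (forall m, e (f m) = e (g m)) -> f = g).
Proof.
have [j [e [j_inj e_exact e_img]]] := Gamma_counit A; exists e => M coM.
have [M0 _] := coM; split=> [h|f g fg].
  apply: (comodule_lift (Tor1_action A) j_inj e_exact coM) => m.
  apply: e_img.
  exact: (hom_to_action (tens_action u A) (lcomp (tens_unit u A) h)).
have [h hE] : exists h : {linear M -> Tor1 Ub A}, forall m, j (h m) = (f - g) m.
  apply: linear_lift => // m; apply/e_exact.
  by rewrite [X in e X]/(f m - g m) linearB fg subrr.
apply: linear_ext => m; apply/eqP; rewrite -subr_eq0.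
by rewrite -[_ - _]hE (hom_to_action (Tor1_action A)) // linear0.
Qed.
End Coreflection.

Theorem corollary3p6 (R U : pzRingType) (u : {rmorphism R -> U})
    (u_epi : ring_epi u)
    (Tor1_UU : is_zero (Tor1 (restr_bimodule u) (restr u : lmodType R)))
    (fdU : flat_dim_le 1 (restr_right u)) :
  grothendieck (comodule_category u) /\
  forall J : module_category R, injective_cogenerator J ->
  exists GJ : comodule u (Gamma u J),
    injective_cogenerator (exist (comodule u) (Gamma u J) GJ
                           : comodule_category u).
Proof.
have [K [G [f [g [f_inj gf g_surj flatG flatK]]]]] := fdU.
pose F := FlatResolution f_inj gf g_surj flatG flatK.
split=> [|J [J_inj J_cogen]]; first exact: (comodule_grothendieck F).
exists (Gamma_comodule u_epi Tor1_UU F J).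
have [e e_univ] := Gamma_coreflection u_epi F J.
split=> [a b i /(monoP F) i_inj h|a b h h' hh'].
  have i_mono : @mono (module_category R) (carrier a) (carrier b) (cofun i).
    move=> x p q pq; apply: linear_ext => y; apply: i_inj.
    exact: (congr1 (fun p : {linear _ -> _} => p y) pq).
  have [k kE] := J_inj _ _ _ i_mono (lcomp e (cofun h)).
  have [/(_ k)[k' k'E] _] := e_univ _ (carrierP b).
  have [_ e_uniq] := e_univ _ (carrierP a).
  exists k'; apply: e_uniq => y; apply: etrans (k'E _) _.
  exact: (congr1 (fun p : {linear _ -> _} => p y) kE).
have [k kh] := J_cogen _ _ (cofun h) (cofun h') hh'.
have [/(_ k)[k' k'E] _] := e_univ _ (carrierP b).
exists k' => kk; apply: kh; apply: linear_ext => y.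
rewrite /= -!k'E; congr (e _); exact: (cofun_eq kk y).
Qed.
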